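(* Let $\mathbf{A}=(A,\rhd,+,-)$ be the irack on $A=\{1,a,b,c,d,e,f\}$ given by the tables in the context, let $\mathbf{TRel}_{\mathbf{A}}$ be the associated braided strict monoidal category of tangled relations, and let $n\ge 3$. Let $T_n:A^n\to A^n$ be the torsion on $n$ strings in $\mathbf{TRel}_{\mathbf{A}}$. Then the relations $R:I\to A^n$ and $S:A^n\to I$ given by $$R=\{(a,c,d,1,\dots,1),\,(b,e,f,1,\dots,1)\},\qquad S=\{(a,e,f,1,\dots,1),\,(b,c,d,1,\dots,1)\}$$ (with $n-3$ entries equal to $1$ at the end of each tuple; that is, $()\,R\,\mathbf{x}$ exactly for the two listed tuples $\mathbf{x}$, and $\mathbf{x}\,S\,()$ exactly for the two listed tuples $\mathbf{x}$) are arrows of $\mathbf{TRel}_{\mathbf{A}}$, and the composite $SR:I\to I$ is the empty relation, while $S\,T_n^2\,R:I\to I$ is the one-point relation $\{((),())\}$. Hence, for every $n\ge 3$, the blocked two torsion is different from the blocked identity on $n$ strings: in the free category $\mathcal{F}_n$ described in the context, $S\,T_n^2\,R\neq S\,R$. In particular, the blocked braid group $\mathbf{BB}_3$ on three strings has exactly $12$ elements.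
   Context: Composites are written right to left: $SR$ means first $R$, then $S$. An irack $\mathbf{A}=(A,\rhd,+,-)$ is a set $A$ with unary operations $x\mapsto x^+$, $x\mapsto x^-$ and a binary operation $\rhd$ such that for all $x,y,z\in A$: (1) $(x^+)^-=x=(x^-)^+$; (2) $x\rhd x^-=x^+$; (3) $x^-\rhd(x\rhd y)=y$; (4) $x\rhd(x^-\rhd y)=y$; (5) $x\rhd(y\rhd z)=(x\rhd y)\rhd(x\rhd z)$; (6) $x\rhd y^-=(x\rhd y)^-$. The irack used here has $A=\{1,a,b,c,d,e,f\}$ and: $1^+=1$, $a^+=b$, $b^+=a$, $c^+=f$, $d^+=c$, $e^+=d$, $f^+=e$; $1^-=1$, $a^-=b$, $b^-=a$, $c^-=d$, $d^-=e$, $e^-=f$, $f^-=c$; for $x\in\{1,a,b\}$, $x\rhd y=y$ for all $y\in A$; for $x\in\{c,d,e,f\}$, $x\rhd 1=1$, $x\rhd a=b$, $x\rhd b=a$, $x\rhd c=e$, $x\rhd d=f$, $x\rhd e=c$, $x\rhd f=d$. Action on tuples: for $\mathbf{x}=(x_1,\dots,x_m)\in A^m$ and $y\in A$, $\mathbf{x}\rhd y=x_1\rhd(x_2\rhd(\cdots(x_m\rhd y)\cdots))$ (equal to $y$ if $m=0$), and $\mathbf{x}\rhd(y_1,\dots,y_k)=(\mathbf{x}\rhd y_1,\dots,\mathbf{x}\rhd y_k)$. The category $\mathbf{TRel}_{\mathbf{A}}$ has as objects the formal powers $A^m$, $m\ge0$ (with $I=A^0$, whose only tuple is $()$), and as arrows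 $A^m\to A^n$ the relations $Q\subseteq A^m\times A^n$ such that whenever $\mathbf{x}\,Q\,\mathbf{y}$, then for every $z\in A$: $(z\rhd\mathbf{x})\,Q\,(z\rhd\mathbf{y})$ and $\mathbf{x}\rhd z=\mathbf{y}\rhd z$. Composition is composition of relations; the strict monoidal structure is given by cartesian product of sets and relations; the braiding is the functional relation $\tau_{m,n}:A^m\times A^n\to A^n\times A^m$, $(\mathbf{x},\mathbf{y})\mapsto(\mathbf{x}\rhd\mathbf{y},\mathbf{x})$. Torsion: in a braided strict monoidal category with braiding $\tau$ and an object $X$, the torsion $T_n:X^n\to X^n$ on $n$ strings is the positive half twist, defined by $T_1=1_X$ and $T_{n+1}=(1_X\otimes T_n)\,\tau_{X^n,X}$. A tangle algebra in a braided strict monoidal category is an object $X$ with arrows $\eta:I\to X\otimes X$ and $\varepsilon:X\otimes X\to I$ such that $(\varepsilon\otimes 1_X)(1_X\otimes\eta)=1_X=(1_X\otimes\varepsilon)(\eta\otimes 1_X)$, $\varepsilon\tau_{X,X}=\varepsilon$ and $\tau_{X,X}\eta=\eta$. Blocked braids: let $\mathcal{F}_n$ be the free braided strict monoidal category generated by one object $X$ equipped with a tangle algebra structure and two further arrows $R:I\to X^n$ and $S:X^n\to I$. Each braid $B$ in the braid group on $n$ strings gives an arrow $B:X^n\to X^n$ by means of the braiding. A blocked braid on $n$ strings is an arrow of $\mathcal{F}_n$ of the form $SBR$; the blocked identity is $SR$ and the blocked two torsion is $ST_n^2R$. The blocked braid group $\mathbf{BB}_n$ is the quotient of the braid group on $n$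 strings in which two braids $B,B'$ are identified when $SBR=SB'R$ in $\mathcal{F}_n$. *)

(* Defs.v *)
From HB Require Import structures.
From mathcomp Require Import all_boot.
From mathcomp Require Import boolp classical_sets functions cardinality.

Set Implicit Arguments.
Unset Strict Implicit.
Unset Printing Implicit Defensive.

Declare Scope bsm_scope.
Delimit Scope bsm_scope with bsm.

(* Transport of an arrow along equalities of its source and target. In a strict
   monoidal category (a ⊗ b) ⊗ c and a ⊗ (b ⊗ c) are equal objects, but in
   general not convertible ones; every use of hcast below is such an
   identification. *)
Definition hcast (O : Type) (H : O -> O -> Type) (a a' b b' : O)
    (ea : a = a') (eb : b = b') (f : H a b) : H a' b' :=
  ecast x (H x b') ea (ecast y (H a y) eb f).
Arguments hcast : simpl never.

(* Braided strict monoidal categories. [comp g f] is "first f, then g". The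
   axioms [tensA], [tens1f], [tensf1] are strictness on arrows, [hex1] and
   [hex2] are the two hexagons, which are triangles in the strict case. *)
Record bsmcat := BSMCat {
  ob :> Type;
  ob1 : ob;
  obT : ob -> ob -> ob;
  obA : associative obT;
  ob1x : left_id ob1 obT;
  obx1 : right_id ob1 obT;
  hom : ob -> ob -> Type;
  idm : forall a, hom a a;
  comp : forall a b c, hom b c -> hom a b -> hom a c;
  tens : forall a b c d, hom a b -> hom c d -> hom (obT a c) (obT b d);
  braid : forall a b, hom (obT a b) (obT b a);
  braidV : forall a b, hom (obT b a) (obT a b);
  compA : forall a b c d (h : hom c d) (g : hom b c) (f : hom a b),
    comp h (comp g f) = comp (comp h g) f;
  comp1f : forall a b (f : hom a b), comp (idm b) f = f;
  compf1 : forall a b (f : hom a b), comp f (idm a) = f;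
  tens_id : forall a b, tens (idm a) (idm b) = idm (obT a b);
  tens_comp : forall a b c a' b' c' (g : hom b c) (f : hom a b)
      (g' : hom b' c') (f' : hom a' b'),
    tens (comp g f) (comp g' f') = comp (tens g g') (tens f f');
  tensA : forall a b c d e k (f : hom a b) (g : hom c d) (h : hom e k),
    hcast (obA a c e) (obA b d k) (tens f (tens g h)) = tens (tens f g) h;
  tens1f : forall a b (f : hom a b),
    hcast (ob1x a) (ob1x b) (tens (idm ob1) f) = f;
  tensf1 : forall a b (f : hom a b),
    hcast (obx1 a) (obx1 b) (tens f (idm ob1)) = f;
  braidK : forall a b, comp (braidV a b) (braid a b) = idm (obT a b);
  braidVK : forall a b, comp (braid a b) (braidV a b) = idm (obT b a);
  braid_nat : forall a b c d (f : hom a b) (g : hom c d),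
    comp (braid b d) (tens f g) = comp (tens g f) (braid a c);
  hex1 : forall a b c,
    braid (obT a b) c =
    comp (hcast (erefl _) (esym (obA c a b)) (tens (braid a c) (idm b)))
         (hcast (obA a b c) (obA a c b) (tens (idm a) (braid b c)));
  hex2 : forall a b c,
    braid a (obT b c) =
    comp (hcast (erefl _) (obA b c a) (tens (idm b) (braid a c)))
         (hcast (esym (obA a b c)) (esym (obA b a c)) (tens (braid a b) (idm c)))
}.

Arguments hom {b} _ _ : rename.
Arguments ob1 {b} : rename.
Arguments obA {b} _ _ _ : rename.
Arguments ob1x {b} _ : rename.
Arguments obx1 {b} _ : rename.
Arguments idm {b} a : rename.
Arguments braid {b} a b : rename.
Arguments braidV {b} a b : rename.

Notation "a ⊗ b" := (obT a b) (at level 38, left associativity) : bsm_scope.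
Notation "f ⊠ g" := (tens f g) (at level 38, left associativity) : bsm_scope.
Notation "g ∘ f" := (comp g f) (at level 40, left associativity) : bsm_scope.
Local Open Scope quotient_scope.
Local Open Scope bsm_scope.

(* X^n, bracketed as X ⊗ (X ⊗ (... ⊗ I)). *)
Definition pow (C : bsmcat) (X : C) (n : nat) : C := iter n (obT X) ob1.

Lemma powSr (C : bsmcat) (X : C) n : pow X n ⊗ X = pow X n.+1.
Proof.
elim: n => [|n IH]; first by rewrite /= ob1x obx1.
by rewrite -[LHS]/(X ⊗ pow X n ⊗ X) -obA IH.
Qed.

(* T_1 = 1 and T_{n+1} = (1_X ⊗ T_n) τ_{X^n,X}. *)
Fixpoint torsion (C : bsmcat) (X : C) (n : nat) {struct n} :
    hom (pow X n) (pow X n) :=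
  match n with
  | 0 => idm (pow X 0)
  | k.+1 =>
      match k return hom (pow X k) (pow X k) -> hom (pow X k.+1) (pow X k.+1) with
      | 0 => fun _ => idm (pow X 1)
      | m.+1 => fun T => (idm X ⊠ T)
          ∘ hcast (powSr X m.+1) (erefl (X ⊗ pow X m.+1)) (braid (pow X m.+1) X)
      end (torsion X k)
  end.

Record tangle_algebra (C : bsmcat) (X : C) := TangleAlgebra {
  ta_eta : hom ob1 (X ⊗ X);
  ta_eps : hom (X ⊗ X) ob1;
  ta_snake1 :
    hcast (erefl _) (ob1x X) (ta_eps ⊠ idm X)
      ∘ hcast (obx1 X) (obA X X X) (idm X ⊠ ta_eta) = idm X;
  ta_snake2 :
    hcast (erefl _) (obx1 X) (idm X ⊠ ta_eps)
      ∘ hcast (ob1x X) (esym (obA X X X)) (ta_eta ⊠ idm X) = idm X;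
  ta_eps_braid : ta_eps ∘ braid X X = ta_eps;
  ta_braid_eta : braid X X ∘ ta_eta = ta_eta
}.

Section Braids.

Variable n : nat.

(* The letter (i, false) is the generator σ_i, with i counted from 0, and
   (i, true) is its inverse. *)
Definition braid_word := seq ('I_n.-1 * bool).

Inductive braid_rel : braid_word -> braid_word -> Prop :=
| br_refl w : braid_rel w w
| br_sym w v : braid_rel w v -> braid_rel v w
| br_trans w v u : braid_rel w v -> braid_rel v u -> braid_rel w u
| br_cat w w' v v' :
    braid_rel w w' -> braid_rel v v' -> braid_rel (w ++ v) (w' ++ v')
| br_cancel i s : braid_rel [:: (i, s); (i, ~~ s)] [::]
| br_far (i j : 'I_n.-1) : i.+1 < j ->
    braid_rel [:: (i, false); (j, false)] [:: (j, false); (i, false)]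
| br_braid (i j : 'I_n.-1) : j = i.+1 :> nat ->
    braid_rel [:: (i, false); (j, false); (i, false)]
              [:: (j, false); (i, false); (j, false)].

Definition braid_relb : rel braid_word := fun w v => `[< braid_rel w v >].

Lemma braid_relb_refl : reflexive braid_relb.
Proof. by move=> w; apply/asboolP; apply: br_refl. Qed.

Lemma braid_relb_sym : symmetric braid_relb.
Proof. by move=> w v; apply/asboolP/asboolP; apply: br_sym. Qed.

Lemma braid_relb_trans : transitive braid_relb.
Proof.
by move=> v w u /asboolP h1 /asboolP h2; apply/asboolP; apply: br_trans h1 h2.
Qed.

Canonical braid_equiv :=
  EquivRel braid_relb braid_relb_refl braid_relb_sym braid_relb_trans.

(* The braid group on n strings. *)
Definition braids := {eq_quot braid_equiv}.

HB.instance Definition _ := Choice.on braids.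

Definition braid_of (w : braid_word) : braids := \pi_({eq_quot braid_equiv}) w.

Lemma braid_ofP w v : braid_of w = braid_of v <-> braid_rel w v.
Proof.
split=> [/eqP|h]; first by rewrite /braid_of eqmodE => /asboolP.
by apply/eqP; rewrite /braid_of eqmodE; apply/asboolP.
Qed.

Lemma braid_ofK (B : braids) : braid_of (repr B) = B.
Proof. exact: reprK. Qed.

Definition word_inv (w : braid_word) : braid_word :=
  rev [seq (g.1, ~~ g.2) | g <- w].

Lemma word_invK : involutive word_inv.
Proof.
move=> w; rewrite /word_inv map_rev revK -map_comp -[RHS]map_id.
by apply: eq_map => -[i s] /=; rewrite negbK.
Qed.

Lemma word_mulV w : braid_rel (w ++ word_inv w) [::].
Proof.
elim: w => [|[i s] w IH]; first exact: br_refl.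
have -> : ((i, s) :: w) ++ word_inv ((i, s) :: w) =
    [:: (i, s)] ++ ((w ++ word_inv w) ++ [:: (i, ~~ s)]).
  by rewrite /word_inv /= rev_cons -cats1 catA.
apply: br_trans (br_cancel i s).
apply: (br_cat (br_refl [:: (i, s)])).
exact: (br_cat IH (br_refl [:: (i, ~~ s)])).
Qed.

Lemma word_mulVl w : braid_rel (word_inv w ++ w) [::].
Proof. by rewrite -{2}[w]word_invK; apply: word_mulV. Qed.

Lemma word_inv_rel w v : braid_rel w v -> braid_rel (word_inv w) (word_inv v).
Proof.
move=> h; apply: (@br_trans _ (word_inv w ++ (v ++ word_inv v))).
  rewrite -[X in braid_rel X _]cats0; apply: br_cat; first exact: br_refl.
  exact/br_sym/word_mulV.
rewrite catA -[X in braid_rel _ X]cat0s; apply: br_cat; last exact: br_refl.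
apply: br_trans (word_mulVl w); apply: br_cat; first exact: br_refl.
exact: br_sym.
Qed.

Definition braid_one : braids := braid_of [::].
Definition braid_mul (B B' : braids) : braids := braid_of (repr B ++ repr B').
Definition braid_inv (B : braids) : braids := braid_of (word_inv (repr B)).

Lemma braid_repr w : braid_rel (repr (braid_of w)) w.
Proof. by apply/braid_ofP; rewrite braid_ofK. Qed.

Lemma braid_mulA : associative braid_mul.
Proof.
move=> A B C; apply/braid_ofP.
apply: (@br_trans _ (repr A ++ (repr B ++ repr C))).
  by apply: br_cat; [apply: br_refl | apply: braid_repr].
rewrite catA; apply: br_cat; last exact: br_refl.
exact/br_sym/braid_repr.
Qed.

Lemma braid_mul1 : left_id braid_one braid_mul.
Proof.
move=> B; rewrite -[RHS]braid_ofK; apply/braid_ofP.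
rewrite -[X in braid_rel _ X]cat0s.
by apply: br_cat; [apply: braid_repr | apply: br_refl].
Qed.

Lemma braid_mul1r : right_id braid_one braid_mul.
Proof.
move=> B; rewrite -[RHS]braid_ofK; apply/braid_ofP.
rewrite -[X in braid_rel _ X]cats0.
by apply: br_cat; [apply: br_refl | apply: braid_repr].
Qed.

Lemma braid_mulV : left_inverse braid_one braid_inv braid_mul.
Proof.
move=> B; apply/braid_ofP; apply: br_trans (word_mulVl (repr B)).
by apply: br_cat; [apply: braid_repr | apply: br_refl].
Qed.

Lemma braid_mulVr : right_inverse braid_one braid_inv braid_mul.
Proof.
move=> B; apply/braid_ofP; apply: br_trans (word_mulV (repr B)).
by apply: br_cat; [apply: br_refl | apply: braid_repr].
Qed.

HB.instance Definition _ := isGroup.Build braids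
  braid_mulA braid_mul1 braid_mul1r braid_mulV braid_mulVr.

End Braids.

Section BraidArrows.

Variables (C : bsmcat) (X : C).

Definition crossing (s : bool) : hom (X ⊗ X) (X ⊗ X) :=
  if s then braidV X X else braid X X.

(* 1_{X^i} ⊗ τ^{±1} ⊗ 1_{X^{n-i-2}}; the identity when i + 1 >= n, a case which
   does not occur for i : 'I_n.-1. *)
Fixpoint sigma (n i : nat) (s : bool) {struct n} : hom (pow X n) (pow X n) :=
  match n with
  | 0 => idm (pow X 0)
  | k.+1 =>
      match i with
      | j.+1 => idm X ⊠ sigma k j s
      | 0 =>
          match k return hom (pow X k.+1) (pow X k.+1) with
          | 0 => idm (pow X 1)
          | m.+1 =>
              hcast (esym (obA X X (pow X m))) (esym (obA X X (pow X m)))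
                    (crossing s ⊠ idm (pow X m))
          end
      end
  end.

Definition word_arrow n (w : braid_word n) : hom (pow X n) (pow X n) :=
  foldr (fun (g : 'I_n.-1 * bool) f => sigma n g.1 g.2 ∘ f) (idm (pow X n)) w.

(* Independent of the representative, by braid_arrowE. *)
Definition braid_arrow n (B : braids n) : hom (pow X n) (pow X n) :=
  word_arrow (repr B).

(* Equality of arrows up to identification of equal sources and targets. *)
Definition heq a b a' b' (f : @hom C a b) (g : @hom C a' b') : Prop :=
  exists (ea : a = a') (eb : b = b'), hcast ea eb f = g.

Lemma heq_refl a b (f : @hom C a b) : heq f f.
Proof. by exists (erefl _), (erefl _). Qed.

Lemma heq_sym a b a' b' (f : @hom C a b) (g : @hom C a' b') :
  heq f g -> heq g f.
Proof. by move=> [ea [eb <-]]; case: _ / ea; case: _ / eb; apply: heq_refl. Qed.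

Lemma heq_trans a b a' b' a'' b'' (f : @hom C a b) (g : @hom C a' b')
    (h : @hom C a'' b'') : heq f g -> heq g h -> heq f h.
Proof. by move=> [ea [eb <-]]; case: _ / ea; case: _ / eb. Qed.

Lemma heq_eq a b (f g : @hom C a b) : heq f g -> f = g.
Proof.
move=> [ea [eb <-]].
by rewrite (Prop_irrelevance ea erefl) (Prop_irrelevance eb erefl).
Qed.

Lemma heq_cast a b a' b' (ea : a = a') (eb : b = b') (f : @hom C a b) :
  heq (hcast ea eb f) f.
Proof. by apply: heq_sym; exists ea, eb. Qed.

Lemma heq_comp a b c a' b' c' (g : @hom C b c) (f : hom a b)
    (g' : @hom C b' c') (f' : hom a' b') :
  heq g g' -> heq f f' -> heq (g ∘ f) (g' ∘ f').
Proof.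
move=> [eb [ec <-]] [ea [eb' <-]]; rewrite (Prop_irrelevance eb' eb) {eb'}.
by case: _ / ea; case: _ / ec; case: _ / eb; apply: heq_refl.
Qed.

Lemma heq_tens a b c d a' b' c' d' (f : @hom C a b) (g : @hom C c d)
    (f' : @hom C a' b') (g' : @hom C c' d') :
  heq f f' -> heq g g' -> heq (f ⊠ g) (f' ⊠ g').
Proof.
move=> [ea [eb <-]] [ec [ed <-]].
case: _ / ea; case: _ / eb; case: _ / ec; case: _ / ed.
exact: heq_refl.
Qed.

Lemma heq_tensA a b c d e k (f : @hom C a b) (g : @hom C c d) (h : @hom C e k) :
  heq (f ⊠ (g ⊠ h)) (f ⊠ g ⊠ h).
Proof. by exists (obA a c e), (obA b d k); apply: tensA. Qed.

Lemma yang_baxter :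
  heq ((braid X X ⊠ idm X) ∘ hcast (obA _ _ _) (obA _ _ _) (idm X ⊠ braid X X)
         ∘ (braid X X ⊠ idm X))
      (hcast (obA _ _ _) (obA _ _ _) (idm X ⊠ braid X X) ∘ (braid X X ⊠ idm X)
         ∘ hcast (obA _ _ _) (obA _ _ _) (idm X ⊠ braid X X)).
Proof.
set p := braid X X ⊠ idm X; set q := hcast _ _ _.
have e : hcast (erefl _) (esym (obA X X X)) p ∘ q ∘ p =
    (idm X ⊠ braid X X) ∘ (hcast (erefl _) (esym (obA X X X)) p ∘ q).
  by rewrite -hex1 braid_nat.
have hp : heq p (hcast (erefl _) (esym (obA X X X)) p).
  exact/heq_sym/heq_cast.
apply: heq_trans (heq_comp (heq_comp hp (heq_refl q)) (heq_refl p)) _.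
rewrite e -[q ∘ p ∘ q]compA.
apply: heq_comp; first exact/heq_sym/heq_cast.
by apply: heq_comp; [apply: heq_sym | apply: heq_refl].
Qed.

Lemma sigma0 k s :
  heq (sigma k.+2 0 s) (crossing s ⊠ idm (pow X k)).
Proof. exact: heq_cast. Qed.

Lemma sigmaS k i s : sigma k.+1 i.+1 s = idm X ⊠ sigma k i s.
Proof. by []. Qed.

Lemma sigma_cancel n i s : i < n.-1 ->
  sigma n i s ∘ sigma n i (~~ s) = idm (pow X n).
Proof.
elim: n i => [|n IH] [|i] //; last first.
  rewrite -[n.+1.-1]/n !sigmaS -tens_comp comp1f => lt_i_n.
  by rewrite IH ?tens_id //; case: n lt_i_n {IH}.
case: n {IH} => [|n _] //; apply: heq_eq.
apply: heq_trans (heq_comp (sigma0 n s) (sigma0 n (~~ s))) _.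
rewrite -tens_comp comp1f.
suff -> : crossing s ∘ crossing (~~ s) = idm (X ⊗ X).
  rewrite -tens_id; apply: heq_trans (heq_sym (heq_tensA _ _ _)) _.
  by rewrite !tens_id; apply: heq_refl.
by case: s; rewrite /crossing /= ?braidK ?braidVK.
Qed.

Lemma sigma_far n i j s t : i.+1 < j -> j < n.-1 ->
  sigma n i s ∘ sigma n j t = sigma n j t ∘ sigma n i s.
Proof.
elim: n i j => [|n IH] [|i] [|j] //; last first.
  rewrite ltnS -[n.+1.-1]/n !sigmaS -!tens_comp !comp1f => ij lt_j_n.
  by rewrite IH //; case: n lt_j_n {IH}.
case: n {IH} => [|n] //; case: j => [|j] // _ _; apply: heq_eq.
have hj : heq (sigma n.+2 j.+2 t) (idm (X ⊗ X) ⊠ sigma n j t).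
  by rewrite !sigmaS -tens_id; apply: heq_tensA.
apply: heq_trans (heq_comp (sigma0 n s) hj) _.
apply: heq_trans (heq_sym (heq_comp hj (sigma0 n s))).
by rewrite -!tens_comp !comp1f !compf1; apply: heq_refl.
Qed.

Lemma sigma_braid n i : i.+1 < n.-1 ->
  sigma n i false ∘ (sigma n i.+1 false ∘ sigma n i false) =
  sigma n i.+1 false ∘ (sigma n i false ∘ sigma n i.+1 false).
Proof.
elim: n i => [|n IH] [|i] //; last first.
  rewrite -[n.+1.-1]/n ![sigma n.+1 _ _]sigmaS -!tens_comp !comp1f => lt_i_n.
  by rewrite IH //; case: n lt_i_n {IH}.
case: n {IH} => [|[|n]] // _; apply: heq_eq; rewrite !compA.
set p := braid X X ⊠ idm X.
set q := hcast (obA _ _ _) (obA _ _ _) (idm X ⊠ braid X X).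
have hp : heq (sigma n.+3 0 false) (p ⊠ idm (pow X n)).
  apply: heq_trans (sigma0 _ _) _.
  apply: heq_trans (heq_tensA _ _ _).
  by apply: heq_tens; [apply: heq_refl | rewrite -tens_id; apply: heq_refl].
have hq : heq (sigma n.+3 1 false) (q ⊠ idm (pow X n)).
  rewrite sigmaS.
  apply: heq_trans (heq_tens (heq_refl _) (sigma0 _ _)) _.
  apply: heq_trans (heq_tensA _ _ _) _.
  by apply: heq_tens; [apply/heq_sym/heq_cast | apply: heq_refl].
apply: heq_trans (heq_comp (heq_comp hp hq) hp) _.
apply: heq_trans (heq_sym (heq_comp (heq_comp hq hp) hq)).
rewrite -!tens_comp !comp1f; apply: heq_tens (heq_refl _).
exact: yang_baxter.
Qed.

Lemma word_arrow_cat n (w v : braid_word n) :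
  word_arrow (w ++ v) = word_arrow w ∘ word_arrow v.
Proof. by elim: w => [|g w IH] /=; rewrite ?comp1f // IH compA. Qed.

Lemma word_arrow_rel n (w v : braid_word n) :
  braid_rel w v -> word_arrow w = word_arrow v.
Proof.
elim=> {w v} //.
- by move=> w v u _ -> _ ->.
- by move=> w w' v v' _ IH1 _ IH2; rewrite !word_arrow_cat IH1 IH2.
- by move=> i s; rewrite /word_arrow /= compf1 sigma_cancel.
- by move=> i j lt_ij; rewrite /word_arrow /= !compf1 sigma_far.
- move=> i j eij; rewrite /word_arrow /= !compf1 eij sigma_braid //.
  by rewrite -eij.
Qed.

Lemma braid_arrowE n (w : braid_word n) : braid_arrow (braid_of w) = word_arrow w.
Proof. exact/word_arrow_rel/braid_repr. Qed.

End BraidArrows.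

(* The free braided strict monoidal category on an object X with a tangle
   algebra structure and arrows R : I -> X^n and S : X^n -> I. The object X^m is
   the natural number m, so that X is 1, I is 0 and the tensor product of
   objects is addition; arrows are formal expressions modulo the least
   congruence containing the axioms. *)
Section Free.

Variable n : nat.

(* Provably equal to n, and convertible to pow 1 n in freecat below. *)
Let Xn : nat := iter n (addn 1) 0.

Inductive fterm : nat -> nat -> Type :=
| t_id a : fterm a a
| t_comp a b c : fterm b c -> fterm a b -> fterm a c
| t_tens a b c d : fterm a b -> fterm c d -> fterm (a + c) (b + d)
| t_braid a b : fterm (a + b) (b + a)
| t_braidV a b : fterm (b + a) (a + b)
| t_eta : fterm 0 (1 + 1)
| t_eps : fterm (1 + 1) 0
| t_R : fterm 0 Xn
| t_S : fterm Xn 0.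

Inductive feq : forall a b, fterm a b -> fterm a b -> Prop :=
| fe_refl a b (f : fterm a b) : feq f f
| fe_sym a b (f g : fterm a b) : feq f g -> feq g f
| fe_trans a b (f g h : fterm a b) : feq f g -> feq g h -> feq f h
| fe_comp a b c (g g' : fterm b c) (f f' : fterm a b) :
    feq g g' -> feq f f' -> feq (t_comp g f) (t_comp g' f')
| fe_tens a b c d (f f' : fterm a b) (g g' : fterm c d) :
    feq f f' -> feq g g' -> feq (t_tens f g) (t_tens f' g')
| fe_compA a b c d (h : fterm c d) (g : fterm b c) (f : fterm a b) :
    feq (t_comp h (t_comp g f)) (t_comp (t_comp h g) f)
| fe_comp1f a b (f : fterm a b) : feq (t_comp (t_id b) f) f
| fe_compf1 a b (f : fterm a b) : feq (t_comp f (t_id a)) f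
| fe_tens_id a b : feq (t_tens (t_id a) (t_id b)) (t_id (a + b))
| fe_tens_comp a b c a' b' c' (g : fterm b c) (f : fterm a b)
      (g' : fterm b' c') (f' : fterm a' b') :
    feq (t_tens (t_comp g f) (t_comp g' f'))
        (t_comp (t_tens g g') (t_tens f f'))
| fe_tensA a b c d e k (f : fterm a b) (g : fterm c d) (h : fterm e k) :
    feq (hcast (addnA a c e) (addnA b d k) (t_tens f (t_tens g h)))
        (t_tens (t_tens f g) h)
| fe_tens1f a b (f : fterm a b) :
    feq (hcast (add0n a) (add0n b) (t_tens (t_id 0) f)) f
| fe_tensf1 a b (f : fterm a b) :
    feq (hcast (addn0 a) (addn0 b) (t_tens f (t_id 0))) f
| fe_braidK a b : feq (t_comp (t_braidV a b) (t_braid a b)) (t_id (a + b))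
| fe_braidVK a b : feq (t_comp (t_braid a b) (t_braidV a b)) (t_id (b + a))
| fe_braid_nat a b c d (f : fterm a b) (g : fterm c d) :
    feq (t_comp (t_braid b d) (t_tens f g)) (t_comp (t_tens g f) (t_braid a c))
| fe_hex1 a b c :
    feq (t_braid (a + b) c)
        (t_comp
          (hcast (erefl _) (esym (addnA c a b)) (t_tens (t_braid a c) (t_id b)))
          (hcast (addnA a b c) (addnA a c b) (t_tens (t_id a) (t_braid b c))))
| fe_hex2 a b c :
    feq (t_braid a (b + c))
        (t_comp
          (hcast (erefl _) (addnA b c a) (t_tens (t_id b) (t_braid a c)))
          (hcast (esym (addnA a b c)) (esym (addnA b a c))
             (t_tens (t_braid a b) (t_id c))))
| fe_snake1 :
    feq (t_comp
          (hcast (erefl _) (add0n 1) (t_tens t_eps (t_id 1)))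
          (hcast (addn0 1) (addnA 1 1 1) (t_tens (t_id 1) t_eta)))
        (t_id 1)
| fe_snake2 :
    feq (t_comp
          (hcast (erefl _) (addn0 1) (t_tens (t_id 1) t_eps))
          (hcast (add0n 1) (esym (addnA 1 1 1)) (t_tens t_eta (t_id 1))))
        (t_id 1)
| fe_eps_braid : feq (t_comp t_eps (t_braid 1 1)) t_eps
| fe_braid_eta : feq (t_comp (t_braid 1 1) t_eta) t_eta.

HB.instance Definition _ a b := gen_eqMixin (fterm a b).
HB.instance Definition _ a b := gen_choiceMixin (fterm a b).

Section Hom.

Variables a b : nat.

Definition feqb : rel (fterm a b) := fun f g => `[< feq f g >].

Lemma feqb_refl : reflexive feqb.
Proof. by move=> f; apply/asboolP; apply: fe_refl. Qed.

Lemma feqb_sym : symmetric feqb.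
Proof. by move=> f g; apply/asboolP/asboolP; apply: fe_sym. Qed.

Lemma feqb_trans : transitive feqb.
Proof.
by move=> g f h /asboolP h1 /asboolP h2; apply/asboolP; apply: fe_trans h1 h2.
Qed.

Canonical feq_equiv := EquivRel feqb feqb_refl feqb_sym feqb_trans.

Definition fhom := {eq_quot feq_equiv}.

Definition fclass (f : fterm a b) : fhom := \pi_({eq_quot feq_equiv}) f.

Definition frepr (f : fhom) : fterm a b := repr f.

Lemma fclassP f g : fclass f = fclass g <-> feq f g.
Proof.
split=> [/eqP|h]; first by rewrite /fclass eqmodE => /asboolP.
by apply/eqP; rewrite /fclass eqmodE; apply/asboolP.
Qed.

Lemma freprK f : fclass (frepr f) = f.
Proof. exact: reprK. Qed.

Lemma frepr_feq f : feq (frepr (fclass f)) f.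
Proof. by apply/fclassP; rewrite freprK. Qed.

End Hom.

Definition f_id a : fhom a a := fclass (t_id a).
Definition f_comp a b c (g : fhom b c) (f : fhom a b) : fhom a c :=
  fclass (t_comp (frepr g) (frepr f)).
Definition f_tens a b c d (f : fhom a b) (g : fhom c d) :
    fhom (a + c) (b + d) := fclass (t_tens (frepr f) (frepr g)).
Definition f_braid a b : fhom (a + b) (b + a) := fclass (t_braid a b).
Definition f_braidV a b : fhom (b + a) (a + b) := fclass (t_braidV a b).

Lemma f_compE a b c (g : fterm b c) (f : fterm a b) :
  f_comp (fclass g) (fclass f) = fclass (t_comp g f).
Proof. by apply/fclassP/fe_comp; apply: frepr_feq. Qed.

Lemma f_tensE a b c d (f : fterm a b) (g : fterm c d) :
  f_tens (fclass f) (fclass g) = fclass (t_tens f g).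
Proof. by apply/fclassP/fe_tens; apply: frepr_feq. Qed.

Lemma f_castE a b a' b' (ea : a = a') (eb : b = b') (f : fterm a b) :
  hcast ea eb (fclass f) = fclass (hcast ea eb f).
Proof. by case: _ / ea; case: _ / eb. Qed.

Lemma fhomP a b (P : fhom a b -> Prop) : (forall f, P (fclass f)) -> forall f, P f.
Proof. by move=> h f; rewrite -(freprK f). Qed.

Definition freecat : bsmcat.
Proof.
refine (@BSMCat nat 0 addn addnA add0n addn0 fhom f_id f_comp f_tens
          f_braid f_braidV _ _ _ _ _ _ _ _ _ _ _ _ _);
  rewrite /f_id /f_braid /f_braidV.
- move=> a b c d; elim/fhomP=> h; elim/fhomP=> g; elim/fhomP=> f.
  by rewrite !f_compE; apply/fclassP/fe_compA.
- by move=> a b; elim/fhomP=> f; rewrite f_compE; apply/fclassP/fe_comp1f.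
- by move=> a b; elim/fhomP=> f; rewrite f_compE; apply/fclassP/fe_compf1.
- by move=> a b; rewrite f_tensE; apply/fclassP/fe_tens_id.
- move=> a b c a' b' c'; elim/fhomP=> g; elim/fhomP=> f.
  elim/fhomP=> g'; elim/fhomP=> f'.
  by rewrite !(f_compE, f_tensE); apply/fclassP/fe_tens_comp.
- move=> a b c d e k; elim/fhomP=> f; elim/fhomP=> g; elim/fhomP=> h.
  by rewrite !f_tensE f_castE; apply/fclassP/fe_tensA.
- move=> a b; elim/fhomP=> f.
  by rewrite f_tensE f_castE; apply/fclassP/fe_tens1f.
- move=> a b; elim/fhomP=> f.
  by rewrite f_tensE f_castE; apply/fclassP/fe_tensf1.
- by move=> a b; rewrite f_compE; apply/fclassP/fe_braidK.
- by move=> a b; rewrite f_compE; apply/fclassP/fe_braidVK.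
- move=> a b c d; elim/fhomP=> f; elim/fhomP=> g.
  by rewrite !(f_compE, f_tensE); apply/fclassP/fe_braid_nat.
- move=> a b c; rewrite !f_tensE !f_castE f_compE; exact/fclassP/fe_hex1.
- move=> a b c; rewrite !f_tensE !f_castE f_compE; exact/fclassP/fe_hex2.
Defined.

Definition genX : freecat := 1%N.

Definition genR : hom ob1 (pow genX n) := fclass t_R.

Definition genS : hom (pow genX n) ob1 := fclass t_S.

Definition free_tangle_algebra : tangle_algebra genX.
Proof.
refine (@TangleAlgebra freecat genX (fclass t_eta) (fclass t_eps) _ _ _ _).
- rewrite /= /f_id !f_tensE !f_castE f_compE; exact/fclassP/fe_snake1.
- rewrite /= /f_id !f_tensE !f_castE f_compE; exact/fclassP/fe_snake2.
- by rewrite /= f_compE; apply/fclassP/fe_eps_braid.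
- by rewrite /= f_compE; apply/fclassP/fe_braid_eta.
Defined.

(* S B R. *)
Definition blocked_braid (B : braids n) : @hom freecat ob1 ob1 :=
  genS ∘ braid_arrow genX B ∘ genR.

Definition blocked_eq : rel (braids n) :=
  fun B B' => `[< blocked_braid B = blocked_braid B' >].

Lemma blocked_eq_refl : reflexive blocked_eq.
Proof. by move=> B; apply/asboolP. Qed.

Lemma blocked_eq_sym : symmetric blocked_eq.
Proof. by move=> B B'; apply/asboolP/asboolP. Qed.

Lemma blocked_eq_trans : transitive blocked_eq.
Proof. by move=> B A D /asboolP h1 /asboolP h2; apply/asboolP; rewrite h1. Qed.

Canonical blocked_equiv :=
  EquivRel blocked_eq blocked_eq_refl blocked_eq_sym blocked_eq_trans.

(* BB_n, as a set; only its cardinality is used. *)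
Definition blocked_braids := {eq_quot blocked_equiv}.

End Free.

Record irack := Irack {
  ir_sort :> Type;
  act : ir_sort -> ir_sort -> ir_sort;
  ir_plus : ir_sort -> ir_sort;
  ir_minus : ir_sort -> ir_sort;
  plusK : forall x, ir_minus (ir_plus x) = x;
  minusK : forall x, ir_plus (ir_minus x) = x;
  act_minus : forall x, act x (ir_minus x) = ir_plus x;
  act_minusK : forall x y, act (ir_minus x) (act x y) = y;
  actK_minus : forall x y, act x (act (ir_minus x) y) = y;
  act_distr : forall x y z, act x (act y z) = act (act x y) (act x z);
  act_minusr : forall x y, act x (ir_minus y) = ir_minus (act x y)
}.

Section TRel.

Variable A : irack.

(* The action of a tuple on an element. *)
Definition acts (x : seq A) (y : A) : A := foldr (@act A) y x.

Definition tangled m n (Q : m.-tuple A -> n.-tuple A -> Prop) : Prop :=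
  forall x y, Q x y -> forall z,
    Q (map_tuple (act z) x) (map_tuple (act z) y) /\ acts x z = acts y z.

Definition trel m n := {Q : m.-tuple A -> n.-tuple A -> Prop | tangled Q}.

Lemma trel_ext m n (Q P : trel m n) :
  (forall x y, sval Q x y <-> sval P x y) -> Q = P.
Proof.
case: Q P => [Q hQ] [P hP] /= h; apply: eq_exist.
by apply/funext => x; apply/funext => y; apply/propext.
Qed.

Lemma acts_cat x y z : acts (x ++ y) z = acts x (acts y z).
Proof. exact: foldr_cat. Qed.

Lemma act_acts z x y : act z (acts x y) = acts (map (act z) x) (act z y).
Proof. by elim: x => //= t x IH; rewrite act_distr IH. Qed.

Lemma acts_map_acts x y z :
  acts (map (acts x) y) (acts x z) = acts x (acts y z).
Proof.
elim: x y z => [|t x IH] y z; first by rewrite /= map_id.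
rewrite -[map _ y]/(map (act t \o acts x) y) map_comp /= -act_acts.
by rewrite IH.
Qed.

Lemma acts_inv x : exists2 y, cancel (acts x) (acts y) & cancel (acts y) (acts x).
Proof.
elim: x => [|t x [y h1 h2]]; first by exists [::].
exists (y ++ [:: ir_minus t]) => u; rewrite acts_cat /=.
  by rewrite act_minusK h1.
by rewrite h2 actK_minus.
Qed.

Lemma acts_inj x : injective (acts x).
Proof. by have [y /can_inj] := acts_inv x. Qed.

Lemma map_acts_inv x : exists y, forall n (t : n.-tuple A),
  map_tuple (acts x) (map_tuple (acts y) t) = t.
Proof.
have [y _ h] := acts_inv x; exists y => n t.
by apply: val_inj; rewrite /= mapK.
Qed.

Lemma tangled_acts m n (Q : trel m n) (s : seq A) x y : sval Q x y ->
  sval Q (map_tuple (acts s) x) (map_tuple (acts s) y).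
Proof.
elim: s => [|z s IH] hQ.
  have e k (t : k.-tuple A) : map_tuple (acts [::]) t = t.
    by apply: val_inj; rewrite /= map_id.
  by rewrite !e.
have [h _] := svalP Q _ _ (IH hQ) z.
have e k (t : k.-tuple A) :
    map_tuple (acts (z :: s)) t = map_tuple (act z) (map_tuple (acts s) t).
  by apply: val_inj; rewrite /= -map_comp.
by rewrite !e.
Qed.

Definition rel_id m (x y : m.-tuple A) : Prop := x = y.

Definition rel_comp m n p (P : n.-tuple A -> p.-tuple A -> Prop)
    (Q : m.-tuple A -> n.-tuple A -> Prop) (x : m.-tuple A) (z : p.-tuple A) :=
  exists2 y, Q x y & P y z.

Definition rel_tens m n p q (Q : m.-tuple A -> n.-tuple A -> Prop)
    (P : p.-tuple A -> q.-tuple A -> Prop)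
    (x : (m + p).-tuple A) (y : (n + q).-tuple A) : Prop :=
  exists x1 x2 y1 y2,
    [/\ x = cat_tuple x1 x2, y = cat_tuple y1 y2, Q x1 y1 & P x2 y2].

Definition rel_braid m n (u : (m + n).-tuple A) (v : (n + m).-tuple A) : Prop :=
  exists (x : m.-tuple A) (y : n.-tuple A),
    u = cat_tuple x y /\ v = cat_tuple (map_tuple (acts x) y) x.

Definition rel_braidV m n (v : (n + m).-tuple A) (u : (m + n).-tuple A) : Prop :=
  rel_braid u v.

Lemma map_cat_tuple (f : A -> A) m n (x : m.-tuple A) (y : n.-tuple A) :
  map_tuple f (cat_tuple x y) = cat_tuple (map_tuple f x) (map_tuple f y).
Proof. by apply: val_inj; rewrite /= map_cat. Qed.

Lemma tangled_id m : tangled (@rel_id m).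
Proof. by move=> x y ->. Qed.

Lemma tangled_comp m n p (P : trel n p) (Q : trel m n) :
  tangled (rel_comp (sval P) (sval Q)).
Proof.
move=> x z [y hQ hP] t.
have [hQ' eQ] := svalP Q _ _ hQ t; have [hP' eP] := svalP P _ _ hP t.
by rewrite eQ eP; split=> //; exists (map_tuple (act t) y).
Qed.

Lemma tangled_tens m n p q (Q : trel m n) (P : trel p q) :
  tangled (rel_tens (sval Q) (sval P)).
Proof.
move=> x y [x1] [x2] [y1] [y2] [-> -> hQ hP] z.
have [hQ' _] := svalP Q _ _ hQ z; have [hP' eP] := svalP P _ _ hP z.
have [_ eQ] := svalP Q _ _ hQ (acts x2 z).
rewrite !map_cat_tuple; split; last by rewrite /= !acts_cat eQ eP.
by exists (map_tuple (act z) x1), (map_tuple (act z) x2),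
  (map_tuple (act z) y1), (map_tuple (act z) y2).
Qed.

Lemma tangled_braid m n : tangled (@rel_braid m n).
Proof.
move=> _ _ [x] [y] [-> ->] z; rewrite !map_cat_tuple; split.
  exists (map_tuple (act z) x), (map_tuple (act z) y); split=> //.
  congr cat_tuple; apply: val_inj; rewrite /= -!map_comp.
  by apply: eq_map => t /=; rewrite act_acts.
by rewrite /= !acts_cat acts_map_acts.
Qed.

Lemma tangled_braidV m n : tangled (@rel_braidV m n).
Proof. by move=> x y /tangled_braid h z; have [h1 ->] := h z. Qed.

Definition tr_id m : trel m m := exist _ _ (@tangled_id m).
Definition tr_comp m n p (P : trel n p) (Q : trel m n) : trel m p :=
  exist _ _ (@tangled_comp _ _ _ P Q).
Definition tr_tens m n p q (Q : trel m n) (P : trel p q) :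
  trel (m + p) (n + q) := exist _ _ (@tangled_tens _ _ _ _ Q P).
Definition tr_braid m n : trel (m + n) (n + m) :=
  exist _ _ (@tangled_braid m n).
Definition tr_braidV m n : trel (n + m) (m + n) :=
  exist _ _ (@tangled_braidV m n).

Lemma trel_cast m n m' n' (em : m = m') (en : n = n') (Q : trel m n) x y :
  sval (hcast em en Q) x y <-> sval Q (tcast (esym em) x) (tcast (esym en) y).
Proof. by move: x y; case: _ / em; case: _ / en. Qed.

Lemma tuple_split m n (t : (m + n).-tuple A) :
  exists (x : m.-tuple A) (y : n.-tuple A), t = cat_tuple x y.
Proof.
have h1 : size (take m t) == m by rewrite size_takel // size_tuple leq_addr.
have h2 : size (drop m t) == n by rewrite size_drop size_tuple addKn.
by exists (Tuple h1), (Tuple h2); apply: val_inj; rewrite /= cat_take_drop.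
Qed.

Lemma cat_tuple_inj m n (x x' : m.-tuple A) (y y' : n.-tuple A) :
  cat_tuple x y = cat_tuple x' y' -> x = x' /\ y = y'.
Proof.
move=> /(congr1 val) /= e.
have e1 : tval x = x'.
  have := congr1 (take m) e.
  by rewrite !take_cat !size_tuple ltnn subnn !take0 !cats0.
split; apply: val_inj => //=.
have := congr1 (drop m) e.
by rewrite !drop_cat !size_tuple ltnn subnn !drop0.
Qed.

Lemma tr_braidP m n (x : m.-tuple A) (y : n.-tuple A) v :
  sval (tr_braid m n) (cat_tuple x y) v <->
  v = cat_tuple (map_tuple (acts x) y) x.
Proof.
split=> [[x'] [y'] [/cat_tuple_inj [-> ->] ->] //|->].
by exists x, y.
Qed.

Lemma tr_tensP m n p q (Q : trel m n) (P : trel p q) x1 x2 y1 y2 :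
  sval (tr_tens Q P) (cat_tuple x1 x2) (cat_tuple y1 y2) <->
  sval Q x1 y1 /\ sval P x2 y2.
Proof.
split=> [[u1] [u2] [v1] [v2]|[hQ hP]]; last by exists x1, x2, y1, y2.
by move=> [/cat_tuple_inj [-> ->] /cat_tuple_inj [-> ->]].
Qed.

Lemma tcast_cat_tupleA m n p (e : m + n + p = m + (n + p))
    (x : m.-tuple A) (y : n.-tuple A) (z : p.-tuple A) :
  tcast e (cat_tuple (cat_tuple x y) z) = cat_tuple x (cat_tuple y z).
Proof. by apply: val_inj; rewrite /= val_tcast /= catA. Qed.

Lemma tcast_cat_tupleAr m n p (e : m + (n + p) = m + n + p)
    (x : m.-tuple A) (y : n.-tuple A) (z : p.-tuple A) :
  tcast e (cat_tuple x (cat_tuple y z)) = cat_tuple (cat_tuple x y) z.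
Proof. by apply: val_inj; rewrite /= val_tcast /= catA. Qed.

Lemma tr_braidK m n : tr_comp (tr_braidV m n) (tr_braid m n) = tr_id (m + n).
Proof.
apply: trel_ext => x z; split=> [[y]|].
  have [x1 [x2 ->]] := tuple_split x; move=> /tr_braidP ->.
  move=> [z1] [z2] [-> /cat_tuple_inj [e ex]]; rewrite -{}ex in e *.
  congr cat_tuple; apply: val_inj => /=.
  by move/(congr1 val): e => /=; apply: inj_map; apply: acts_inj.
move=> <-; have [x1 [x2 ->]] := tuple_split x.
by exists (cat_tuple (map_tuple (acts x1) x2) x1) => /=; exists x1, x2.
Qed.

Lemma tr_braidVK m n : tr_comp (tr_braid m n) (tr_braidV m n) = tr_id (n + m).
Proof.
apply: trel_ext => x z; split=> [[y]|].
  move=> [x1] [x2] [-> ->] [z1] [z2] [/cat_tuple_inj [-> ->] ->] //.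
move=> <-; have [x2 [x1 ->]] := tuple_split x.
have [s hs] := map_acts_inv x1.
exists (cat_tuple x1 (map_tuple (acts s) x2)); last exact/tr_braidP/esym/congr2.
by exists x1, (map_tuple (acts s) x2); rewrite hs.
Qed.

Definition TRel : bsmcat.
Proof.
refine (@BSMCat nat 0 addn addnA add0n addn0 trel tr_id tr_comp tr_tens
          tr_braid tr_braidV _ _ _ _ _ _ _ _ tr_braidK tr_braidVK _ _ _).
- move=> a b c d h g f; apply: trel_ext => x t; split.
    by move=> [z [y hf hg] hh]; exists y => //; exists z.
  by move=> [y hf [z hg hh]]; exists z => //; exists y.
- move=> a b f; apply: trel_ext => x y; split; first by move=> [z h <-].
  by move=> h; exists y.
- move=> a b f; apply: trel_ext => x y; split; first by move=> [z <- h].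
  by move=> h; exists x.
- move=> a b; apply: trel_ext => x y; split.
    by move=> [x1] [x2] [y1] [y2] [-> -> /= <- <-].
  have [x1 [x2 ->]] := tuple_split x; have [y1 [y2 ->]] := tuple_split y.
  by move=> /cat_tuple_inj [<- <-]; apply/tr_tensP.
- move=> a b c a' b' c' g f g' f'; apply: trel_ext => x z; split.
    move=> [x1] [x2] [z1] [z2] [-> -> [y1 hf hg] [y2 hf' hg']].
    by exists (cat_tuple y1 y2); apply/tr_tensP.
  move=> [y [x1] [x2] [y1] [y2] [-> -> hf hf']].
  have [z1 [z2 ->]] := tuple_split z; move=> /tr_tensP [hg hg'].
  by apply/tr_tensP; split; [exists y1 | exists y2].
- move=> a b c d e k f g h; apply: trel_ext => x y.
  rewrite trel_cast.
  have [x12 [x3 ->]] := tuple_split x; have [x1 [x2 ->]] := tuple_split x12.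
  have [y12 [y3 ->]] := tuple_split y; have [y1 [y2 ->]] := tuple_split y12.
  by rewrite !tcast_cat_tupleA !tr_tensP; tauto.
- move=> a b f; apply: trel_ext => x y; rewrite trel_cast.
  have e k (t : k.-tuple A) : tcast (esym (add0n k)) t = cat_tuple [tuple] t.
    by apply: val_inj; rewrite /= val_tcast.
  by rewrite !e tr_tensP; split=> [[]|].
- move=> a b f; apply: trel_ext => x y; rewrite trel_cast.
  have e k (t : k.-tuple A) : tcast (esym (addn0 k)) t = cat_tuple t [tuple].
    by apply: val_inj; rewrite /= val_tcast /= cats0.
  by rewrite !e tr_tensP; split=> [[]|].
- move=> a b c d f g; apply: trel_ext => x z; split.
    move=> [y [x1] [x2] [y1] [y2] [-> -> hf hg]] /tr_braidP ->.
    exists (cat_tuple (map_tuple (acts x1) x2) x1); first exact/tr_braidP.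
    apply/tr_tensP; split=> //.
    have -> : map_tuple (acts x1) x2 = map_tuple (acts y1) x2.
      by apply: val_inj; apply: eq_map => t; have [_] := svalP f _ _ hf t.
    exact: tangled_acts.
  have [x1 [x2 ->]] := tuple_split x; have [z2 [z1 ->]] := tuple_split z.
  move=> [y /tr_braidP ->] /tr_tensP [hg hf].
  have ex : map_tuple (acts x1) =1 map_tuple (acts z1) :> (c.-tuple A -> _).
    by move=> t; apply: val_inj; apply: eq_map => u; have [_] := svalP f _ _ hf u.
  rewrite ex in hg.
  have [s hs] := map_acts_inv z1.
  exists (cat_tuple z1 (map_tuple (acts s) z2)); last by apply/tr_braidP; rewrite hs.
  apply/tr_tensP; split=> //.
  have -> : x2 = map_tuple (acts s) (map_tuple (acts z1) x2).
    apply: val_inj; apply: (inj_map (@acts_inj z1)).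
    by have /(congr1 val) := hs _ (map_tuple (acts z1) x2).
  exact: tangled_acts.
- move=> a b c; apply: trel_ext => x z.
  have [x12 [x3 ->]] := tuple_split x; have [x1 [x2 ->]] := tuple_split x12.
  rewrite tr_braidP.
  set w := map_tuple _ _.
  have ew : w = map_tuple (acts x1) (map_tuple (acts x2) x3).
    by apply: val_inj; rewrite /= -map_comp; apply: eq_map => t; apply: acts_cat.
  split=> [->|[y /trel_cast + /trel_cast]].
    exists (cat_tuple (cat_tuple x1 (map_tuple (acts x2) x3)) x2).
      rewrite trel_cast !tcast_cat_tupleA tr_tensP; split=> //; exact/tr_braidP.
    rewrite trel_cast tcast_cat_tupleAr tr_tensP; split=> //.
    by rewrite tr_braidP ew.
  have [y13 [y2 ->]] := tuple_split y; have [y1 [y3 ->]] := tuple_split y13.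
  rewrite !tcast_cat_tupleA => /tr_tensP [<- /tr_braidP /cat_tuple_inj [-> ->]].
  have [z1 [z23 ->]] := tuple_split z; have [z2 [z3 ->]] := tuple_split z23.
  rewrite tcast_cat_tupleAr => /tr_tensP [/tr_braidP /cat_tuple_inj [-> ->] <-].
  by rewrite ew.
- move=> a b c; apply: trel_ext => x z.
  have [x1 [x23 ->]] := tuple_split x; have [x2 [x3 ->]] := tuple_split x23.
  rewrite tr_braidP map_cat_tuple.
  split=> [->|[y /trel_cast + /trel_cast]].
    exists (cat_tuple (map_tuple (acts x1) x2) (cat_tuple x1 x3)).
      by rewrite trel_cast !tcast_cat_tupleAr tr_tensP; split=> //; exact/tr_braidP.
    rewrite trel_cast tcast_cat_tupleA tr_tensP; split=> //; exact/tr_braidP.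
  have [y2 [y13 ->]] := tuple_split y; have [y1 [y3 ->]] := tuple_split y13.
  rewrite !tcast_cat_tupleAr => /tr_tensP [/tr_braidP /cat_tuple_inj [-> ->] <-].
  have [z12 [z3 ->]] := tuple_split z; have [z1 [z2 ->]] := tuple_split z12.
  by rewrite tcast_cat_tupleA => /tr_tensP [<- /tr_braidP /cat_tuple_inj [-> ->]].
Defined.

End TRel.

(* The letter l1 is the element 1 of A. *)
Inductive letter := l1 | la | lb | lc | ld | le | lf.

Definition letter_plus (x : letter) : letter :=
  match x with
  | l1 => l1 | la => lb | lb => la | lc => lf | ld => lc | le => ld | lf => le
  end.

Definition letter_minus (x : letter) : letter :=
  match x with
  | l1 => l1 | la => lb | lb => la | lc => ld | ld => le | le => lf | lf => lc
  end.

Definition letter_act (x y : letter) : letter :=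
  match x with
  | l1 | la | lb => y
  | lc | ld | le | lf =>
      match y with
      | l1 => l1 | la => lb | lb => la | lc => le | ld => lf | le => lc | lf => ld
      end
  end.

Definition irack7 : irack.
Proof.
refine (@Irack letter letter_act letter_plus letter_minus _ _ _ _ _ _ _).
all: try by case.
all: try by case; case.
all: by case; case; case.
Defined.

(* Entries equal to 1 at the end: n - 3 of them, for n >= 3. *)
Definition pad (n : nat) (s : seq letter) : seq letter := s ++ nseq (n - 3) l1.

Definition genA : TRel irack7 := 1%N.

Definition relR (n : nat) (_ : 0.-tuple irack7)
    (x : (pow genA n).-tuple irack7) : Prop :=
  tval x = pad n [:: la; lc; ld] \/ tval x = pad n [:: lb; le; lf].

Definition relS (n : nat) (x : (pow genA n).-tuple irack7)
    (_ : 0.-tuple irack7) : Prop :=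
  tval x = pad n [:: la; le; lf] \/ tval x = pad n [:: lb; lc; ld].

Arguments relR : clear implicits.
Arguments relS : clear implicits.

(* Main.v *)
Require Import Defs.
From mathcomp Require Import all_boot.
From mathcomp Require Import boolp classical_sets functions cardinality.

(** Interpreting the free category in TRel sends the cup to the pairs (x^-, x)
    and the cap to the pairs (x, x^-). In TRel, T_n^2 sends a tuple x to the
    tuple of the x ▷ x_i^{--}; on (a, c, d, 1, ..., 1), whose action is trivial,
    this gives (a, e, f, 1, ..., 1), so the interpretations of S T_n^2 R and S R
    differ.

    For three strings, an arrow Q : I -> X ⊗ Y is determined through the cup by
    an arrow X -> Y, so a strand of Q can be carried once around the others:
    σ_1 σ_2 σ_2 σ_1 Q = Q. Applied to all Q = B R, this makes BB_3 a quotient of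
    the spherical braid group, which has twelve elements. Conversely, the images
    of {(a, c, d), (b, e, f)} under twelve normal forms are pairwise disjoint, so
    interpreting S as the converse of one of these images separates that normal
    form from the others. *)

Set Implicit Arguments.
Unset Strict Implicit.
Unset Printing Implicit Defensive.

Local Open Scope quotient_scope.
Local Open Scope bsm_scope.

(** * Torsion and crossings as maps on tuples *)

Section HalfTwist.

Variable A : irack.
Implicit Types (x : seq A) (u v : A).

(** The step of the torsion brings the last string to the front, so the recursion runs over the
    reversed tuple. *)
Fixpoint half_twist_rev x : seq A :=
  if x is u :: x' then acts (rev x') u :: half_twist_rev x' else [::].

Definition half_twist x : seq A := half_twist_rev (rev x).

Lemma half_twist_rcons x u :
  half_twist (rcons x u) = acts x u :: half_twist x.
Proof. by rewrite /half_twist rev_rcons /= revK. Qed.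

(** The mirror recursion, in which the first string passes over all the others. The full twist needs
    both: the inner half twist puts the last entry in front, where the outer one must remove it. *)
Lemma half_twist_cons u x :
  half_twist (u :: x) = rcons (map (act u) (half_twist x)) u.
Proof.
elim/last_ind: x => [//|x v IH].
by rewrite -rcons_cons !half_twist_rcons IH.
Qed.

Lemma act_self_minus2 u : act u (ir_minus (ir_minus u)) = u.
Proof. by rewrite act_minusr act_minus plusK. Qed.

Lemma act_acts_swap x u v : act (acts x u) (acts x v) = acts x (act u v).
Proof. exact: (acts_map_acts x [:: u] v). Qed.

(* A full twist lets the whole tuple act on every string; applying ir_minus
   twice undoes the action of the string on itself. *)
Lemma half_twist2 x :
  half_twist (half_twist x) = map (fun u => acts x (ir_minus (ir_minus u))) x.
Proof.
elim/last_ind: x => [//|x u IH].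
rewrite half_twist_rcons half_twist_cons IH map_rcons -map_comp.
congr rcons; last by rewrite -cats1 acts_cat /= act_self_minus2.
by apply: eq_map => v /=; rewrite act_acts_swap -cats1 acts_cat.
Qed.

(** The effect of σ_i on tuples. The last branch covers indices out of range, where [sigma] is the
    identity too. *)
Fixpoint cross (i : nat) x : seq A :=
  match i, x with
  | 0, u :: v :: x' => act u v :: u :: x'
  | j.+1, u :: x' => u :: cross j x'
  | _, _ => x
  end.

Let X : TRel A := 1%N.

Lemma torsionP n (x y : (pow X n).-tuple A) :
  sval (torsion X n) x y <-> tval y = half_twist x.
Proof.
have idP k (u v : (pow X k).-tuple A) : sval (tr_id A (pow X k)) u v <-> tval v = u.
  by split=> [->//|e]; apply: val_inj.
case: n x y => [|n] x y.
  by rewrite idP; case: (tval x) (size_tuple x).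
elim: n x y => [|n IH] x y.
  by rewrite idP; case: (tval x) (size_tuple x) => [|u [|]].
have -> : torsion X n.+2 = (idm X ⊠ torsion X n.+1)
    ∘ hcast (powSr X n.+1) (erefl (X ⊗ pow X n.+1)) (braid (pow X n.+1) X).
  by [].
set e := esym (powSr X n.+1).
have [u [v euv]] := @tuple_split A (pow X n.+1) 1 (tcast e x).
have ex : tval x = u ++ v by rewrite -[RHS]/(tval (cat_tuple u v)) -euv val_tcast.
have [y1 [y2 ->]] := @tuple_split A 1 (pow X n.+1) y.
case: (tupleP v) euv ex => t v'; rewrite (tuple0 v') => euv ex {v v'}.
rewrite ex cats1 half_twist_rcons.
split=> [[z /trel_cast hz]|/= ey].
  move: hz; rewrite -/e euv => /tr_braidP /= ->.
  by move=> /(tr_tensP (tr_id A 1) (torsion X n.+1)) [<- /IH /= ->].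
have [ey1 ey2] : tval y1 = [:: acts u t] /\ tval y2 = half_twist u.
  by case: (tval y1) (size_tuple y1) ey => [|a [|]] // _ [-> ->].
exists (cat_tuple (map_tuple (acts u) [tuple t]) u).
  by apply/trel_cast; rewrite -/e euv; apply/tr_braidP.
by apply/(tr_tensP (tr_id A 1) (torsion X n.+1)); split; [apply: val_inj | apply/IH].
Qed.

Lemma sigmaP n i (x y : (pow X n).-tuple A) :
  sval (sigma X n i false) x y <-> tval y = cross i x.
Proof.
have idP k (u v : (pow X k).-tuple A) : sval (tr_id A (pow X k)) u v <-> tval v = u.
  by split=> [->//|e]; apply: val_inj.
elim: n i x y => [|n IH] [|i] x y.
- by rewrite idP; case: (tval x) (size_tuple x).
- by rewrite idP; case: (tval x) (size_tuple x).
- case: n {IH} x y => [|n] x y.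
    by rewrite idP; case: (tval x) (size_tuple x) => [|u [|]].
  set e := obA X X (pow X n).
  have [u [v euv]] := @tuple_split A (1 + 1) (pow X n) (tcast e x).
  have [u' [v' euv']] := @tuple_split A (1 + 1) (pow X n) (tcast e y).
  have ex : tval x = u ++ v by rewrite -[RHS]/(tval (cat_tuple u v)) -euv val_tcast.
  have ey : tval y = u' ++ v' by rewrite -[RHS]/(tval (cat_tuple u' v')) -euv' val_tcast.
  have -> : sval (sigma X n.+2 0 false) x y <->
      sval (tr_tens (tr_braid A 1 1) (tr_id A (pow X n))) (tcast e x) (tcast e y).
    by rewrite trel_cast !esymK.
  rewrite euv euv' tr_tensP ex ey {euv euv' ex ey}.
  case: (tupleP u) => a {}u; case: (tupleP u) => b {}u; rewrite (tuple0 u) {u}.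
  have -> : [tuple of [:: a; b]] = cat_tuple [tuple a] [tuple b].
    exact: val_inj.
  rewrite tr_braidP idP.
  split=> [[-> /= ->] //|/= h].
  suff [h1 ->] : tval u' = [:: act a b; a] /\ tval v' = v.
    by split=> //; apply: val_inj.
  by case: (tval u') (size_tuple u') h => [|a' [|b' [|]]] // _ [-> -> ->].
have [x1 [x2 ->]] := @tuple_split A 1 (pow X n) x.
have [y1 [y2 ->]] := @tuple_split A 1 (pow X n) y.
rewrite sigmaS tr_tensP IH.
case: (tupleP x1) => a {}x1; rewrite (tuple0 x1) /=.
split=> [[<- ->] //|].
case: (tupleP y1) => b {}y1; rewrite (tuple0 y1) /= => -[-> ->].
by [].
Qed.

Lemma positive_word_arrowP n (w : braid_word n) (x y : (pow X n).-tuple A) :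
  all (fun g => ~~ g.2) w ->
  sval (word_arrow X w) x y <-> tval y = foldr (fun g : 'I_n.-1 * bool => cross g.1) x w.
Proof.
elim: w y => [|[i s] w IH] y /=.
  by move=> _; split=> [->//|e]; apply: val_inj.
move=> /andP [/negPf -> /IH {}IH].
split=> [[z /IH <- /sigmaP] //|ey].
have hz : size (foldr (fun g : 'I_n.-1 * bool => cross g.1) x w) == pow X n.
  have size_cross j (v : seq A) : size (cross j v) = size v.
    by elim: j v => [[|? []]|j IHj [|? ?]] //=; rewrite IHj.
  elim: w {IH ey} => [|g w IH] /=; first by rewrite size_tuple.
  by rewrite size_cross.
by exists (Tuple hz); [apply/IH | apply/sigmaP].
Qed.

End HalfTwist.

(** * The tangle algebra in tangled relations *)

Section TRelTangle.

Variable A : irack.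
Let X : TRel A := 1%N.

Definition rel_eta (_ : 0.-tuple A) (y : 2.-tuple A) : Prop :=
  exists u, tval y = [:: ir_minus u; u].

Definition rel_eps (x : 2.-tuple A) (_ : 0.-tuple A) : Prop :=
  exists u, tval x = [:: u; ir_minus u].

Lemma tangled_eta : tangled rel_eta.
Proof.
move=> x y [u ey] z; split.
  by exists (act z u); rewrite /= ey /= act_minusr.
by rewrite (tuple0 x) ey /= act_minusK.
Qed.

Lemma tangled_eps : tangled rel_eps.
Proof.
move=> x y [u ex] z; split.
  by exists (act z u); rewrite /= ex /= act_minusr.
by rewrite (tuple0 y) ex /= actK_minus.
Qed.

Definition tr_eta : trel A 0 2 := exist _ _ tangled_eta.
Definition tr_eps : trel A 2 0 := exist _ _ tangled_eps.

(** Needed for τη = η: the braiding sends the cup pair (u^-, u) to (u^- ▷ u, u^-), which is the cup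
    pair of u^-. *)
Lemma act_minus_self (u : A) : act (ir_minus u) u = ir_minus (ir_minus u).
Proof.
by rewrite -{2}[u]plusK -[ir_plus u]act_minus -act_minusr act_minusK.
Qed.

Lemma ir_minus_inj : injective (@ir_minus A).
Proof. exact: can_inj (@minusK A). Qed.

Definition trel_tangle_algebra : tangle_algebra X.
Proof.
refine (@TangleAlgebra (TRel A) X tr_eta tr_eps _ _ _ _);
  apply: trel_ext => x z.
- split.
    move=> [y /trel_cast [x1] [x2] [y1] [y2] [ex ey e1 [u eu]]].
    move=> /trel_cast [a1] [a2] [b1] [b2] [ea eb [v ev] e2].
    move: (congr1 val ex) (congr1 val ey) (congr1 val ea) (congr1 val eb).
    rewrite -e1 -e2 /= !val_tcast eu ev (tuple0 x2) (tuple0 b1) /= cats0.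
    move=> {}ex {}ey {}ea {}eb; apply: val_inj => /=; rewrite ex eb.
    move: ea; rewrite ey; case: (tval x1) (size_tuple x1) => [|t [|]] // _.
    by case=> -> /ir_minus_inj -> <-.
  move=> <-; case: (tupleP x) => u {}x; rewrite (tuple0 x) {x}.
  exists [tuple u; ir_minus u; u]; apply/trel_cast.
    exists [tuple u], [tuple], [tuple u], [tuple ir_minus u; u]; split=> //.
    - by apply: val_inj; rewrite /= ?val_tcast.
    - by apply: val_inj; rewrite /= ?val_tcast.
    - by exists u.
  exists [tuple u; ir_minus u], [tuple u], [tuple], [tuple u]; split=> //.
  - by apply: val_inj; rewrite /= ?val_tcast.
  - by apply: val_inj; rewrite /= ?val_tcast.
  - by exists u.
- split.
    move=> [y /trel_cast [x1] [x2] [y1] [y2] [ex ey [u eu] e1]].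
    move=> /trel_cast [a1] [a2] [b1] [b2] [ea eb e2 [v ev]].
    move: (congr1 val ex) (congr1 val ey) (congr1 val ea) (congr1 val eb).
    rewrite -e1 -e2 /= !val_tcast eu ev (tuple0 x1) (tuple0 b2) /= cats0.
    move=> {}ex {}ey {}ea {}eb; apply: val_inj => /=; rewrite ex eb.
    move: ea; rewrite ey; case: (tval a1) (size_tuple a1) => [|t [|]] // _.
    by case=> <- ->.
  move=> <-; case: (tupleP x) => u {}x; rewrite (tuple0 x) {x}.
  (* The cap joins the middle entry v to the last entry u, so v^- = u, that is, v = u^+. *)
  exists [tuple u; ir_plus u; u]; apply/trel_cast.
    exists [tuple], [tuple u], [tuple u; ir_plus u], [tuple u]; split=> //.
    - by apply: val_inj; rewrite /= ?val_tcast.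
    - by apply: val_inj; rewrite /= ?val_tcast.
    - by exists (ir_plus u); rewrite plusK.
  exists [tuple u], [tuple ir_plus u; u], [tuple u], [tuple]; split=> //.
  - by apply: val_inj; rewrite /= ?val_tcast.
  - by apply: val_inj; rewrite /= ?val_tcast.
  - by exists (ir_plus u); rewrite plusK.
- case: (tupleP x) => u {}x; case: (tupleP x) => v {}x; rewrite (tuple0 x) {x}.
  have -> : [tuple of [:: u; v]] = cat_tuple [tuple u] [tuple v] by exact: val_inj.
  split=> [[y /(@tr_braidP A 1 1) -> [w [<- /= e]]]|[w [-> ->]]].
    exists u; congr [:: _; _].
    (* After applying u ▷, both sides equal u^+. *)
    by apply: (@acts_inj A [:: u]); rewrite /= act_minus {2}e minusK.
  exists (cat_tuple (map_tuple (acts [tuple w]) [tuple ir_minus w]) [tuple w]).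
    exact/(@tr_braidP A 1 1).
  by exists (ir_plus w); rewrite /= act_minus plusK.
- split=> [[y [u ey]]|[u ez]].
    have -> : y = cat_tuple [tuple ir_minus u] [tuple u] by exact: val_inj.
    move=> /(@tr_braidP A 1 1) ->; exists (ir_minus u).
    by rewrite /= act_minus_self.
  (* The cup pair of u^+ is (u, u^+), and u ▷ u^+ = u^-, so it braids to (u^-, u). *)
  exists (cat_tuple [tuple u] [tuple ir_plus u]); first by exists (ir_plus u); rewrite /= plusK.
  apply/(@tr_braidP A 1 1); apply: val_inj; rewrite /= [LHS]ez.
  by rewrite -{3}[u]plusK act_minus_self plusK.
Defined.
End TRelTangle.

(** * The functor from the free category to tangled relations *)

Section Interpretation.

Variables (n : nat) (A : irack).
Let X : TRel A := 1%N.
Variables (R : hom ob1 (pow X n)) (S : hom (pow X n) ob1).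

(** In both categories objects are natural numbers and the tensor product is addition, so the
    functor is the identity on objects, and [R] and [S] have the required types without a cast. *)
Fixpoint interp_term a b (t : fterm n a b) : @hom (TRel A) a b :=
  match t in fterm _ a b return @hom (TRel A) a b with
  | t_id a => @idm (TRel A) a
  | t_comp _ _ _ g f => interp_term g ∘ interp_term f
  | t_tens _ _ _ _ f g => interp_term f ⊠ interp_term g
  | t_braid a b => @braid (TRel A) a b
  | t_braidV a b => @braidV (TRel A) a b
  | t_eta => tr_eta A
  | t_eps => tr_eps A
  | t_R => R
  | t_S => S
  end.

Lemma interp_term_cast a b a' b' (ea : a = a') (eb : b = b') (f : fterm n a b) :
  interp_term (hcast ea eb f) = @hcast (TRel A) _ _ _ _ _ ea eb (interp_term f).
Proof. by case: _ / ea; case: _ / eb. Qed.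

(** Apart from the congruence rules, each rule of [feq] is an axiom of [bsmcat] or [tangle_algebra].
    Hence [interp] does not depend on the representative it chooses. *)
Lemma interp_term_feq a b (f g : fterm n a b) :
  feq f g -> interp_term f = interp_term g.
Proof.
elim=> {a b f g} //=.
- by move=> a b f g h _ -> _ ->.
- by move=> a b c g g' f f' _ -> _ ->.
- by move=> a b c d f f' g g' _ -> _ ->.
- by move=> *; apply: (@Defs.compA (TRel A)).
- by move=> *; apply: (@comp1f (TRel A)).
- by move=> *; apply: (@compf1 (TRel A)).
- by move=> *; apply: (@tens_id (TRel A)).
- by move=> *; apply: (@tens_comp (TRel A)).
- by move=> *; rewrite interp_term_cast; apply: (@tensA (TRel A)).
- by move=> *; rewrite interp_term_cast; apply: (@tens1f (TRel A)).
- by move=> *; rewrite interp_term_cast; apply: (@tensf1 (TRel A)).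
- by move=> *; apply: (@braidK (TRel A)).
- by move=> *; apply: (@braidVK (TRel A)).
- by move=> *; apply: (@braid_nat (TRel A)).
- by move=> *; rewrite !interp_term_cast; apply: (@hex1 (TRel A)).
- by move=> *; rewrite !interp_term_cast; apply: (@hex2 (TRel A)).
- by rewrite !interp_term_cast; apply: (ta_snake1 (trel_tangle_algebra A)).
- by rewrite !interp_term_cast; apply: (ta_snake2 (trel_tangle_algebra A)).
- exact: (ta_eps_braid (trel_tangle_algebra A)).
- exact: (ta_braid_eta (trel_tangle_algebra A)).
Qed.

Definition interp (a b : nat) (f : @hom (freecat n) a b) : @hom (TRel A) a b :=
  interp_term (frepr f).

Lemma interp_class a b (f : fterm n a b) : interp (fclass f) = interp_term f.
Proof. exact/interp_term_feq/frepr_feq. Qed.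

Lemma interp_id a : interp (@idm (freecat n) a) = @idm (TRel A) a.
Proof. exact: interp_class. Qed.

Lemma interp_comp a b c (g : @hom (freecat n) b c) (f : @hom (freecat n) a b) :
  interp (g ∘ f) = interp g ∘ interp f.
Proof. exact: interp_class. Qed.

Lemma interp_tens a b c d (f : @hom (freecat n) a b) (g : @hom (freecat n) c d) :
  interp (f ⊠ g) = interp f ⊠ interp g.
Proof. exact: interp_class. Qed.

Lemma interp_braid a b : interp (@braid (freecat n) a b) = @braid (TRel A) a b.
Proof. exact: interp_class. Qed.

Lemma interp_braidV a b : interp (@braidV (freecat n) a b) = @braidV (TRel A) a b.
Proof. exact: interp_class. Qed.

Lemma interp_cast (a b a' b' : freecat n) (ea : a = a') (eb : b = b')
    (f : hom a b) :
  interp (hcast ea eb f) = @hcast (TRel A) _ _ _ _ _ ea eb (interp f).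
Proof. by case: _ / ea; case: _ / eb. Qed.

Lemma interp_torsion k : interp (torsion (genX n) k) = torsion X k.
Proof.
case: k => [|k]; first exact: interp_id.
elim: k => [|k IH]; first exact: interp_id.
have e (C : bsmcat) (Y : C) : torsion Y k.+2 = (idm Y ⊠ torsion Y k.+1)
    ∘ hcast (powSr Y k.+1) (erefl (Y ⊗ pow Y k.+1)) (braid (pow Y k.+1) Y).
  by [].
rewrite !e interp_comp interp_tens IH interp_id interp_cast interp_braid.
by congr (_ ∘ hcast _ _ _); apply: Prop_irrelevance.
Qed.

Lemma interp_sigma k i s : interp (sigma (genX n) k i s) = sigma X k i s.
Proof.
elim: k i => [|k IH] [|i]; try exact: interp_id.
  case: k {IH} => [|k]; first exact: interp_id.
  rewrite [LHS]interp_cast interp_tens interp_id.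
  have -> : interp (crossing (genX n) s) = crossing X s.
    by case: s; [apply: interp_braidV | apply: interp_braid].
  by congr (hcast _ _ _); apply: Prop_irrelevance.
by rewrite sigmaS interp_tens IH interp_id.
Qed.

Lemma interp_word_arrow k (w : braid_word k) :
  interp (word_arrow (genX n) w) = word_arrow X w.
Proof.
elim: w => [|g w IH] /=; first exact: interp_id.
by rewrite interp_comp interp_sigma IH.
Qed.

Lemma interp_genR : interp (genR n) = R.
Proof. exact: interp_class. Qed.

Lemma interp_genS : interp (genS n) = S.
Proof. exact: interp_class. Qed.

End Interpretation.

(** * Carrying one strand around the others *)

Section Encircling.

Variables (C : bsmcat) (X : C) (ta : tangle_algebra X).

Lemma heq_tens1f a b (f : @hom C a b) : heq (idm ob1 ⊠ f) f.
Proof. by exists (ob1x a), (ob1x b); apply: tens1f. Qed.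

Lemma heq_tensf1 a b (f : @hom C a b) : heq (f ⊠ idm ob1) f.
Proof. by exists (obx1 a), (obx1 b); apply: tensf1. Qed.

Lemma heq_comp_tens a b c d (f : @hom C a b) (g : @hom C c d) :
  (f ⊠ idm d) ∘ (idm a ⊠ g) = f ⊠ g.
Proof. by rewrite -tens_comp compf1 comp1f. Qed.

(** [Q'] is [Q] with its first end bent by the cap. Reattaching the cup creates a zigzag, which
    [ta_snake2] straightens. *)
Lemma cup_factor Y (Q : hom ob1 (X ⊗ Y)) :
  exists Q' : hom X Y, Q = (idm X ⊠ Q') ∘ ta_eta ta.
Proof.
pose q := hcast (obx1 X) (obA X X Y) (idm X ⊠ Q).
pose e := hcast (erefl _) (ob1x Y) (ta_eps ta ⊠ idm Y).
exists (e ∘ q); apply: heq_eq; apply: heq_sym.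
have := ta_snake2 ta; set s1 := hcast _ _ _; set s2 := hcast _ _ _ => snake.
have he : heq (idm X ⊠ e) (s1 ⊠ idm Y).
  apply: heq_trans (heq_tens (heq_refl _) (heq_cast _ _ _)) _.
  apply: heq_trans (heq_tensA _ _ _) _.
  by apply: heq_tens; [apply/heq_sym/heq_cast | apply: heq_refl].
(* Cup and [Q] involve disjoint strings, so by interchange the cup can be moved after [Q]. *)
have hq : heq ((idm X ⊠ q) ∘ ta_eta ta) ((s2 ⊠ idm Y) ∘ Q).
  have h1 : heq (idm X ⊠ q) (idm (X ⊗ X) ⊠ Q).
    apply: heq_trans (heq_tens (heq_refl _) (heq_cast _ _ _)) _.
    by rewrite -tens_id; apply: heq_tensA.
  apply: heq_trans (heq_comp h1 (heq_sym (heq_tensf1 _))) _.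
  rewrite -tens_comp comp1f compf1 -heq_comp_tens.
  apply: heq_comp (heq_tens1f _).
  apply: heq_trans (heq_tens (heq_refl _) _) _.
    by rewrite -tens_id; apply: heq_refl.
  apply: heq_trans (heq_tensA _ _ _) _.
  by apply: heq_tens; [apply/heq_sym/heq_cast | apply: heq_refl].
have -> : idm X ⊠ (e ∘ q) = (idm X ⊠ e) ∘ (idm X ⊠ q).
  by rewrite -tens_comp comp1f.
rewrite -Defs.compA; apply: heq_trans (heq_comp he hq) _.
by rewrite Defs.compA -tens_comp snake comp1f tens_id comp1f; apply: heq_refl.
Qed.

(* Factoring Q through the cup, the encircling double braid slides past the
   rest of Q and becomes the double crossing of the two ends of the cup. *)
Lemma encircle Y (Q : hom ob1 (X ⊗ Y)) : braid Y X ∘ braid X Y ∘ Q = Q.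
Proof.
have [Q' ->] := cup_factor Q.
rewrite [in LHS]Defs.compA -[braid Y X ∘ braid X Y ∘ _]Defs.compA braid_nat.
rewrite Defs.compA braid_nat -!Defs.compA.
by rewrite (ta_braid_eta ta) (ta_braid_eta ta).
Qed.

Lemma heq_braid (a b a' b' : C) :
  a = a' -> b = b' -> heq (braid a b) (braid a' b').
Proof. by move=> -> ->; apply: heq_refl. Qed.

(** By the hexagons, [s ∘ t] is the braiding of X^2 with X and [t ∘ s] that of X with X^2, so this
    is [encircle] with Y = X^2. *)
Lemma encircle_sigma (Q : hom ob1 (pow X 3)) :
  let s := sigma X 3 0 false in let t := sigma X 3 1 false in
  s ∘ (t ∘ (t ∘ (s ∘ Q))) = Q.
Proof.
move=> s t.
have ht : heq t (idm X ⊠ braid X X).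
  apply: heq_tens; first exact: heq_refl.
  exact: heq_trans (sigma0 X 0 false) (heq_tensf1 _).
have eX : pow X 1 = X by rewrite /= obx1.
have h1 : heq (s ∘ t) (braid (pow X 2) X).
  rewrite [braid _ X]hex1; apply: heq_comp.
    by apply: heq_trans (sigma0 _ _ _) _; apply/heq_sym/heq_cast.
  apply: heq_trans ht _; apply: heq_trans (heq_sym (heq_cast _ _ _)).
  by apply: heq_tens; [apply: heq_refl | apply: heq_braid].
have h2 : heq (t ∘ s) (braid X (pow X 2)).
  rewrite [braid X _]hex2; apply: heq_comp.
    apply: heq_trans ht _; apply: heq_trans (heq_sym (heq_cast _ _ _)).
    by apply: heq_tens; [apply: heq_refl | apply: heq_braid].
  apply: heq_trans (sigma0 _ _ _) _; exact/heq_sym/heq_cast.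
rewrite -[RHS]encircle; apply: heq_eq.
have -> : s ∘ (t ∘ (t ∘ (s ∘ Q))) = s ∘ t ∘ (t ∘ s) ∘ Q by rewrite !Defs.compA.
by apply: heq_comp (heq_refl _); apply: heq_comp.
Qed.

End Encircling.

(** * Separating the two torsion from the identity *)

Section SevenElementIrack.

Lemma pow_TRel (A : irack) n : pow (1%N : TRel A) n = n.
Proof. by elim: n => //= n ->. Qed.

Lemma acts_pad n (s : seq irack7) (u : irack7) : @acts irack7 (pad n s) u = acts s u.
Proof.
rewrite /pad acts_cat; congr acts.
by elim: (n - 3) => //= k ->.
Qed.

Lemma map_pad (f : letter -> letter) n s :
  f l1 = l1 -> map f (pad n s) = pad n (map f s).
Proof. by move=> fl1; rewrite /pad map_cat map_nseq fl1. Qed.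

(** The letters 1, a, b act trivially; c, d, e, f all act by the same involution, which exchanges
    the two tuples. Each tuple contains two of the latter letters, so its own action is trivial. *)
Lemma tangled_relR n : @tangled irack7 0 (pow genA n) (relR n).
Proof.
move=> x y hxy z; rewrite (tuple0 x) /relR /=; split.
  by case: hxy => ->; rewrite map_pad; case: z; auto.
by case: hxy => ->; rewrite acts_pad; case: z.
Qed.

Lemma tangled_relS n : @tangled irack7 (pow genA n) 0 (relS n).
Proof.
move=> x y hxy z; rewrite (tuple0 y) /relS /=; split.
  by case: hxy => ->; rewrite map_pad; case: z; auto.
by case: hxy => ->; rewrite acts_pad; case: z.
Qed.

Definition tr_R n : @hom (TRel irack7) ob1 (pow genA n) :=
  exist _ (relR n) (@tangled_relR n).
Definition tr_S n : @hom (TRel irack7) (pow genA n) ob1 :=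
  exist _ (relS n) (@tangled_relS n).

Lemma tr_SR n : sval (tr_S n ∘ tr_R n) = (fun _ _ => False).
Proof.
apply/funext => x; apply/funext => y; apply/propext; split=> // -[z].
by case=> ez [] /=; rewrite ez.
Qed.

Lemma half_twist2_pad n (s : seq letter) :
  @half_twist irack7 (@half_twist irack7 (pad n s)) =
  pad n (map (fun u => @acts irack7 s (letter_minus (letter_minus u))) s).
Proof.
rewrite half_twist2 -(@map_pad _ n s); last first.
  by elim: s => //= u s ->; case: u.
by apply: eq_map => u; rewrite acts_pad.
Qed.

Lemma tr_STTR n : 3 <= n ->
  sval (tr_S n ∘ (torsion genA n ∘ torsion genA n) ∘ tr_R n) =
    (fun x y => x = [tuple] /\ y = [tuple]).
Proof.
move=> le3n; apply/funext => x; apply/funext => y; apply/propext.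
rewrite (tuple0 x) (tuple0 y); split=> // _.
have size_ok s : size s = 3 -> size (pad n s) == pow genA n.
  by move=> es; rewrite pow_TRel size_cat es size_nseq subnKC.
have ht s : size (half_twist (s : seq irack7)) = size s.
  rewrite /half_twist -[RHS]size_rev.
  by elim: (rev s) => //= u s' ->.
have hx := size_ok [:: la; lc; ld] erefl.
have hy : size (@half_twist irack7 (pad n [:: la; lc; ld])) == pow genA n.
  by rewrite ht.
have hz := size_ok [:: la; le; lf] erefl.
exists (Tuple hx); first by left.
exists (Tuple hz); last by left.
exists (Tuple hy); first exact/torsionP.
by apply/torsionP; rewrite /= half_twist2_pad.
Qed.

Lemma blocked_two_torsion_neq n : 3 <= n ->
  genS n ∘ (torsion (genX n) n ∘ torsion (genX n) n) ∘ genR n <> genS n ∘ genR n.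
Proof.
move=> le3n /(congr1 (@interp _ _ (tr_R n) (tr_S n) 0 0)).
rewrite !interp_comp !interp_torsion interp_genR interp_genS.
move=> /(congr1 sval); rewrite tr_SR tr_STTR //.
move=> /(congr1 (fun P => P [tuple] [tuple])) e.
by suff : False by []; rewrite -e.
Qed.

End SevenElementIrack.

(** * Consequences of the spherical braid relations *)

Section SphericalRelations.

Variables (U : Type) (s t : U -> U).
Hypotheses (s_inj : injective s) (t_inj : injective t).
Hypothesis sts : forall x, s (t (s x)) = t (s (t x)).
Hypothesis stts : forall x, s (t (t (s x))) = x.

(** By injectivity the relator stts may be rotated cyclically; the next two lemmas continue the
    rotation. *)
Lemma ttss x : t (t (s (s x))) = x.
Proof. exact/s_inj/stts. Qed.

Lemma tsst x : t (s (s (t x))) = x.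
Proof. exact/t_inj/ttss. Qed.

Lemma sstt x : s (s (t (t x))) = x.
Proof. exact/t_inj/tsst. Qed.

Lemma sst x : s (s (t x)) = t (s (s x)).
Proof. by rewrite -[x]tsst sstt tsst. Qed.

(** Let Δ = sts. The braid relation gives ttΔ = Δss, and ss commutes with t by [sst], hence with Δ.
    So tt and ss agree on the image of Δ, which is everything. *)
Lemma tt_ss x : t (t x) = s (s x).
Proof.
have [y ->] : exists y, x = s (t (s y)).
  (* An explicit preimage under sts: in the resulting word, two relators stts and one tsst
     cancel. *)
  by exists (t (t (s (s (s (t (t (t (s x))))))))); rewrite stts tsst stts.
by rewrite -(sts (s y)) -(sts (s (s y))) -sst.
Qed.

Lemma s_pow4 x : s (s (s (s x))) = x.
Proof. by rewrite -tt_ss ttss. Qed.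

End SphericalRelations.

(** * Normal forms of braids on three strings *)

Section ThreeStrings.

Definition sigma1 : 'I_3.-1 := @Ordinal 2 0 isT.
Definition sigma2 : 'I_3.-1 := @Ordinal 2 1 isT.

(* The spherical braid group on three strings is an extension of S_3 by the
   group of order two generated by the full twist, which equals [:: s; s]. *)
Definition normal_forms : seq (braid_word 3) :=
  let s := (sigma1, false) in let t := (sigma2, false) in
  let perms := [:: [::]; [:: s]; [:: t]; [:: s; t]; [:: t; s]; [:: s; t; s]] in
  perms ++ [seq [:: s; s] ++ w | w <- perms].

Definition normal_form k : braid_word 3 := nth [::] normal_forms k.

Variables (C : bsmcat) (X : C) (ta : tangle_algebra X).

Let U := @hom C ob1 (pow X 3).
(** Braids act on arrows I -> X^3 by postcomposition, because the encircling relation is proved for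
    such arrows and not for endomorphisms of X^3. *)
Let cr (g : 'I_3.-1 * bool) (Q : U) : U := sigma X 3 g.1 g.2 ∘ Q.

Lemma word_arrow_foldr (w : braid_word 3) (Q : U) :
  word_arrow X w ∘ Q = foldr cr Q w.
Proof.
elim: w => [|g w IH] /=; first by rewrite comp1f.
by rewrite -Defs.compA IH.
Qed.

Lemma crK i b : cancel (cr (i, b)) (cr (i, ~~ b)).
Proof.
have := @sigma_cancel C X 3 i (~~ b) (ltn_ord i); rewrite negbK => e Q.
by rewrite /cr /= Defs.compA e comp1f.
Qed.

Lemma ordI2 (i : 'I_3.-1) : i = sigma1 \/ i = sigma2.
Proof. by case: i => -[|[|//]] h; [left|right]; apply: val_inj. Qed.

Let s : U -> U := cr (sigma1, false).
Let t : U -> U := cr (sigma2, false).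

Let s_inj : injective s := can_inj (@crK _ _).
Let t_inj : injective t := can_inj (@crK _ _).

Let crossing_sts x : s (t (s x)) = t (s (t x)).
Proof.
have := @sigma_braid C X 3 0 isT; rewrite !Defs.compA => e.
by rewrite /s /t /cr [sigma1 : nat]/= [sigma2 : nat]/= !Defs.compA e.
Qed.

Let crossing_stts x : s (t (t (s x))) = x.
Proof. exact: (encircle_sigma ta). Qed.

Let crossing_tt := tt_ss s_inj t_inj crossing_sts crossing_stts.
Let crossing_s_pow4 := s_pow4 s_inj t_inj crossing_sts crossing_stts.

Lemma normal_form_stable i k : k < 12 ->
  exists2 j, j < 12 & forall Q,
    cr (i, false) (foldr cr Q (normal_form k)) = foldr cr Q (normal_form j).
Proof.
move=> ltk; have tss x : t (s (s x)) = s (s (t x)) by rewrite (sst s_inj t_inj).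
have tst x : t (s (t x)) = s (t (s x)) by rewrite crossing_sts.
have tsts x : t (s (t (s x))) = s (s (s (t x))) by rewrite tst tss.
case: (ordI2 i) => ->.
(* Multiplication table: entry k is the index of the normal form of σ_1 times the k-th one. The list
   in the second case does the same for σ_2. *)
- exists (nth 0 [:: 1; 6; 3; 8; 5; 10; 7; 0; 9; 2; 11; 4] k).
    by case: k ltk => [|[|[|[|[|[|[|[|[|[|[|[|k]]]]]]]]]]]] //.
  move=> Q; rewrite -/s.
  by case: k ltk => [|[|[|[|[|[|[|[|[|[|[|[|k]]]]]]]]]]]] // _;
    rewrite /= -/s -/t ?crossing_s_pow4.
- exists (nth 0 [:: 2; 4; 6; 5; 7; 9; 8; 10; 0; 11; 1; 3] k).
    by case: k ltk => [|[|[|[|[|[|[|[|[|[|[|[|k]]]]]]]]]]]] //.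
  move=> Q; rewrite -/t.
  by case: k ltk => [|[|[|[|[|[|[|[|[|[|[|[|k]]]]]]]]]]]] // _;
    rewrite /= -/s -/t ?tss ?tsts ?tst ?crossing_tt ?crossing_s_pow4.
Qed.

(** Both crossings have order dividing four, since their squares agree. Inverse letters thus reduce
    to positive ones. *)
Lemma crossing_inv i Q :
  cr (i, true) Q = cr (i, false) (cr (i, false) (cr (i, false) Q)).
Proof.
apply: (can_inj (@crK i false)); rewrite [LHS](crK i true).
by case: (ordI2 i) => ->; rewrite -/s -/t ?crossing_tt crossing_s_pow4.
Qed.

Lemma word_normal_form (w : braid_word 3) :
  exists2 k, k < 12 & forall Q : U,
    word_arrow X w ∘ Q = word_arrow X (normal_form k) ∘ Q.
Proof.
suff [k lek h] : exists2 k, k < 12 & forall Q,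
    foldr cr Q w = foldr cr Q (normal_form k).
  by exists k => // Q; rewrite !word_arrow_foldr.
elim: w => [|[i b] w [k ltk IH]]; first by exists 0.
have [k1 ltk1 h1] := normal_form_stable i ltk.
case: b; last by exists k1 => // Q; rewrite /= IH h1.
have [k2 ltk2 h2] := normal_form_stable i ltk1.
have [k3 ltk3 h3] := normal_form_stable i ltk2.
exists k3 => // Q.
by rewrite [LHS]/= IH crossing_inv h1 h2 h3.
Qed.

End ThreeStrings.

(** * Counting the blocked braids on three strings *)

Section BlockedBraids3.

Lemma tangled_converse (A : irack) m n (Q : trel A m n) :
  tangled (fun y x => sval Q x y).
Proof. by move=> y x h z; have [h1 ->] := svalP Q _ _ h z. Qed.

Definition tr_converse (A : irack) m n (Q : trel A m n) : trel A n m :=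
  exist _ _ (@tangled_converse _ _ _ Q).

Lemma blocked_normal_form (B : braids 3) :
  exists2 k, k < 12 & blocked_braid B = blocked_braid (braid_of (normal_form k)).
Proof.
have [k ltk h] := word_normal_form (free_tangle_algebra 3) (repr B).
exists k => //; rewrite /blocked_braid braid_arrowE -!Defs.compA; congr (_ ∘ _).
exact: h.
Qed.

(** Numbers make the comparison of tuples computable by [vm_compute]. *)
Definition letter_code (u : letter) : nat :=
  match u with
  | l1 => 0 | la => 1 | lb => 2 | lc => 3 | ld => 4 | le => 5 | lf => 6
  end.

Definition word_image (x : seq letter) k : seq letter :=
  foldr (fun g : 'I_3.-1 * bool => @cross irack7 g.1) x (normal_form k).

Definition cup_words : seq (seq letter) := [:: [:: la; lc; ld]; [:: lb; le; lf]].

Lemma word_image_inj j k (p q : bool) : j < 12 -> k < 12 ->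
  word_image (nth [::] cup_words p) j = word_image (nth [::] cup_words q) k ->
  j = k.
Proof.
pose code p k := map letter_code (word_image (nth [::] cup_words p) k).
pose sep j k := (j == k) || [&& code false j != code false k,
  code false j != code true k, code true j != code false k &
  code true j != code true k].
(* For each pair of distinct indices, the images of both tuples under one normal form are compared
   with both images under the other. *)
have : all (fun j => all (sep j) (iota 0 12)) (iota 0 12) by vm_compute.
move=> /allP h ltj ltk e.
have := h j; rewrite mem_iota => /(_ ltj) /allP /(_ k).
rewrite mem_iota => /(_ ltk) /orP [/eqP //|].
have {}e : code p j = code q k by rewrite /code e.
by case: p q e => -[] -> /and4P []; rewrite ?eqxx.
Qed.

Lemma normal_form_inj j k : j < 12 -> k < 12 ->
  blocked_braid (braid_of (normal_form j)) =
  blocked_braid (braid_of (normal_form k)) -> j = k.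
Proof.
move=> ltj ltk.
pose W i : @hom (TRel irack7) ob1 (pow genA 3) :=
  word_arrow genA (normal_form i) ∘ tr_R 3.
(* With S read as the converse of [W k], the blocked braid of the j-th form is nonempty exactly when
   [W j] and [W k] share a tuple. *)
move=> /(congr1 (@interp _ _ (tr_R 3) (tr_converse (W k)) 0 0)).
rewrite /blocked_braid !interp_comp !braid_arrowE !interp_word_arrow.
rewrite interp_genR interp_genS -!Defs.compA -/(W j) -/(W k).
have WP i y : i < 12 -> sval (W i) [tuple] y <->
    exists p : bool, tval y = word_image (nth [::] cup_words p) i.
  move=> lti.
  have pos : all (fun g : 'I_3.-1 * bool => ~~ g.2) (normal_form i).
    by case: i lti => [|[|[|[|[|[|[|[|[|[|[|[|]]]]]]]]]]]].
  split=> [[x hx /(positive_word_arrowP _ _ pos) ->]|[p ey]].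
    by case: hx => ->; [exists false | exists true].
  exists (if p then [tuple lb; le; lf] else [tuple la; lc; ld]).
    by case: (p); [right | left].
  by apply/(positive_word_arrowP _ _ pos); rewrite ey; case: (p).
move=> /(congr1 (fun Q => sval Q [tuple] [tuple])) e.
have [y /(WP _ _ ltj) [p ey] /(WP _ _ ltk) [q ey']] :
    sval ((tr_converse (W k) : @hom (TRel irack7) _ ob1) ∘ W j) [tuple] [tuple].
  (* The equality replaces [W j] by [W k], which shares a tuple with itself because it is
     nonempty. *)
  rewrite e.
  have sz : size (word_image [:: la; lc; ld] k) == pow genA 3.
    by move: ltk {e}; case: k => [|[|[|[|[|[|[|[|[|[|[|[|]]]]]]]]]]]].
  by exists (Tuple sz); apply/(WP _ _ ltk); exists false.
by apply: (@word_image_inj j k p q) => //; rewrite -ey.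
Qed.

Lemma card_blocked_braids3 : ([set: blocked_braids 3]%classic #= `I_12)%card.
Proof.
pose f k : blocked_braids 3 :=
  \pi_({eq_quot (blocked_equiv 3)}) (braid_of (normal_form k)).
have fE B k : \pi_({eq_quot (blocked_equiv 3)}) B = f k <->
    blocked_braid B = blocked_braid (braid_of (normal_form k)).
  split=> [/eqP|h]; first by rewrite eqmodE => /asboolP.
  by apply/eqP; rewrite eqmodE; apply/asboolP.
have -> : [set: blocked_braids 3]%classic = [set f k | k in `I_12]%classic.
  apply/seteqP; split=> // b _ /=.
  have [k ltk h] := blocked_normal_form (repr b).
  by exists k => //; rewrite -[RHS](reprK b); apply/esym/fE.
apply: inj_card_eq => j k; rewrite !inE /= => ltj ltk /fE.
exact: normal_form_inj.
Qed.

End BlockedBraids3.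

Theorem mainTheorem1 :
  (forall n : nat, 3 <= n ->
     exists (hR : @tangled irack7 0 (pow genA n) (relR n))
            (hS : @tangled irack7 (pow genA n) 0 (relS n)),
       let R : @hom (TRel irack7) ob1 (pow genA n) := exist _ (relR n) hR in
       let S : @hom (TRel irack7) (pow genA n) ob1 := exist _ (relS n) hS in
       let T := torsion genA n in
       sval (S ∘ R) = (fun _ _ => False) /\
       sval (S ∘ (T ∘ T) ∘ R) = (fun x y => x = [tuple] /\ y = [tuple])) /\
  (forall n : nat, 3 <= n ->
     let T := torsion (genX n) n in
     genS n ∘ (T ∘ T) ∘ genR n <> genS n ∘ genR n) /\
  ([set: blocked_braids 3]%classic #= `I_12)%card.
Proof.
split; last by split; [apply: blocked_two_torsion_neq | apply: card_blocked_braids3].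
move=> n le3n; exists (@tangled_relR n), (@tangled_relS n) => R S T.
by split; [apply: tr_SR | apply: tr_STTR].
Qed.
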